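(* Let $F:\mathbb{P}^N_{\mathbb{C}_p}\to\mathbb{P}^N_{\mathbb{C}_p}$ be a lift of Frobenius on $\mathbb{P}^N_{\mathbb{C}_p}$. Let $\{b_i\}_{i\ge 0}$ be a sequence of points in $\mathbb{P}^N_{\mathbb{C}_p}(\mathbb{C}_p)$ satisfying $F(b_i)=b_{i-1}$ for all $i\ge 1$. Let $V$ be a subvariety of $\mathbb{P}^N_{\mathbb{C}_p}$. Then there exists $c>0$ such that for all $i\ge 0$, either $b_i\in V$ or $d(b_i,V)>c$.
   Context: $p$ is a prime and $\mathbb{C}_p$ is the completion of an algebraic closure of $\mathbb{Q}_p$, with norm $|\cdot|$, valuation ring $\mathbb{C}_p^{\circ}$ and maximal ideal $\mathbb{C}_p^{\circ\circ}$. A lift of Frobenius on $\mathbb{P}^N_{\mathbb{C}_p}$ is an endomorphism of the form $$F:[x_0:\cdots:x_N]\mapsto [x_0^q+p'P_0(x_0,\dots,x_N):\cdots:x_N^q+p'P_N(x_0,\dots,x_N)],$$ where $q=p^s$ with $s\geq 1$, $p'\in\mathbb{C}_p^{\circ\circ}$, and $P_0,\dots,P_N\in\mathbb{C}_p^{\circ}[x_0,\dots,x_N]$ are homogeneous polynomials of degree $q$. Distance to a subvariety: for a subvariety $V$ of $\mathbb{P}^N_{\mathbb{C}_p}$, fix homogeneous polynomials $H_1,\dots,H_m\in\mathbb{C}_p[x_0,\dots,x_N]$ defining $V$ with $\|H_i\|=1$ (Gauss norm, i.e. maximum of the absolute values of the coefficients). For $y\in\mathbb{P}^N(\mathbb{C}_p)$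 write $y=[y_0:\cdots:y_N]$ with $\max_i|y_i|=1$ and set $d(y,V):=\max_{1\le i\le m}|H_i(y_0,\dots,y_N)|$ (with $d(y,V)=0$ if $m=0$, i.e. if $V=\mathbb{P}^N$). *)

(* Defs.v *)
From mathcomp Require Export all_boot all_order all_algebra.
From mathcomp Require Export classical_sets reals.
From mathcomp Require Export mpoly.

Set Implicit Arguments.
Unset Strict Implicit.
Unset Printing Implicit Defensive.

Import Order.TTheory GRing.Theory Num.Theory.
Local Open Scope ring_scope.

Record nonarch_absval (R : realType) (K : fieldType) := NonarchAbsval {
  absval_fun :> K -> R;
  absval_ge0 : forall x, 0 <= absval_fun x;
  absval_eq0 : forall x, (absval_fun x == 0) = (x == 0);
  absvalM : forall x y, absval_fun (x * y) = absval_fun x * absval_fun y;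
  absvalD : forall x y,
    absval_fun (x + y) <= Num.max (absval_fun x) (absval_fun y) }.

Definition padic_abs (R : realType) (p : nat) (x : rat) : R :=
  if x == 0 then 0
  else p%:R ^ ((logn p `|denq x|%N)%:Z - (logn p `|numq x|%N)%:Z).

Definition abs_complete (R : realType) (K : fieldType) (v : K -> R) : Prop :=
  forall u : nat -> K,
    (forall e : R, 0 < e -> exists M : nat, forall m n : nat,
       (M <= m)%N -> (M <= n)%N -> v (u m - u n) < e) ->
    exists l : K, forall e : R, 0 < e -> exists M : nat, forall n : nat,
       (M <= n)%N -> v (u n - l) < e.

Record is_completion (R : realType) (F K : fieldType) (w : F -> R) (v : K -> R)
    (iota : {rmorphism F -> K}) : Prop := IsCompletion {
  completion_isometry : forall x, v (iota x) = w x;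
  completion_dense : forall (y : K) (e : R), 0 < e ->
    exists x : F, v (y - iota x) < e;
  completion_complete : abs_complete v }.

Record is_algebraic_closure (F L : fieldType) (iota : {rmorphism F -> L}) :
    Prop := IsAlgebraicClosure {
  algebraic_closure_closed : GRing.closed_field_axiom L;
  algebraic_closure_algebraic : forall x : L, algebraicOver iota x }.

(* C_p is only determined up to isometric isomorphism.  [is_Cp p v] says that
   the field C with absolute value v is a completion of an algebraic closure L
   of a completion Q of the rationals for the p-adic absolute value; in
   particular v is normalised by |p| = 1/p. *)
Definition is_Cp (R : realType) (p : nat) (C : fieldType)
    (v : nonarch_absval R C) : Prop :=
  exists (Q : fieldType) (vQ : nonarch_absval R Q) (ratQ : {rmorphism rat -> Q})
         (L : fieldType) (vL : nonarch_absval R L) (QL : {rmorphism Q -> L})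
         (LC : {rmorphism L -> C}),
    [/\ is_completion (padic_abs R p) vQ ratQ,
        is_algebraic_closure QL,
        forall x : Q, vL (QL x) = vQ x
      & is_completion vL v LC].

(* Points of P^N(K) are the lines through the origin of K^(N+1). *)
Definition proj_space (K : fieldType) (N : nat) : Type :=
  {l : {vspace 'rV[K]_N.+1} | \dim l == 1%N}.

(* x = [u_0 : ... : u_N]; this forces u != 0 since x has dimension 1. *)
Definition hcoords (K : fieldType) (N : nat) (x : proj_space K N)
    (u : 'rV[K]_N.+1) : bool := val x == <[u]>%VS.

Definition mpeval (K : fieldType) (N : nat) (h : {mpoly K[N.+1]})
    (u : 'rV[K]_N.+1) : K := h.@[fun j => u 0 j].

(* The coordinate formula fully determines F, and it makes sense at every
   point: |p'| < 1 prevents its coordinates from vanishing simultaneously. *)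
Definition is_Frobenius_lift (R : realType) (p : nat) (K : fieldType)
    (v : nonarch_absval R K) (N : nat)
    (F : proj_space K N -> proj_space K N) : Prop :=
  exists (s : nat) (p' : K) (P : 'I_N.+1 -> {mpoly K[N.+1]}),
    let q := (p ^ s)%N in
    [/\ (1 <= s)%N,
        v p' < 1,
        forall j, P j \is q.-homog,
        forall j m, v (P j)@_m <= 1
      & forall x u, hcoords x u ->
          hcoords (F x) (\row_j (u 0 j ^+ q + p' * mpeval (P j) u))].

Definition gauss_norm (R : realType) (K : fieldType) (v : nonarch_absval R K)
    (n : nat) (h : {mpoly K[n]}) : R :=
  \big[Num.max/0]_(m <- msupp h) v h@_m.

Definition defining_equations (K : fieldType) (N : nat)
    (V : set (proj_space K N)) (m : nat) (H : 'I_m -> {mpoly K[N.+1]}) : Prop :=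
  (forall i, exists d : nat, H i \is d.-homog) /\
  (forall x u, hcoords x u -> (V x <-> forall i, mpeval (H i) u = 0)).

(* Zariski closed subsets of P^N, not necessarily irreducible. *)
Definition is_subvariety (K : fieldType) (N : nat) (V : set (proj_space K N)) :
    Prop :=
  exists (m : nat) (H : 'I_m -> {mpoly K[N.+1]}), defining_equations V H.

Definition sup_norm (R : realType) (K : fieldType) (v : nonarch_absval R K)
    (N : nat) (u : 'rV[K]_N.+1) : R :=
  \big[Num.max/0]_(j < N.+1) v (u 0 j).

Lemma normalized_coords_exist (R : realType) (K : fieldType)
    (v : nonarch_absval R K) (N : nat) (x : proj_space K N) :
  exists u : 'rV[K]_N.+1, hcoords x u && (sup_norm v u == 1).
Proof.
case: x => l; rewrite /hcoords /= => diml.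
have [w w0 lw] : exists2 w : 'rV[K]_N.+1, w != 0 & l = <[w]>%VS.
  have l0 : l != 0%VS by rewrite -dimv_eq0 (eqP diml).
  exists (vpick l); first by rewrite vpick0.
  apply/esym/eqP; rewrite eqEdim -memvE memv_pick /= (eqP diml).
  by rewrite dim_vline vpick0 l0.
have v_ge0 (z : 'rV[K]_N.+1) (i : 'I_N.+1) :
  true -> (0 <= v (z 0 i))%R by move=> _; exact: absval_ge0.
have [j _ jP] := @Order.TotalTheory.eq_bigmax _ _ _ (0 : R) ord0 xpredT
  (fun i : 'I_N.+1 => v (w 0 i)) isT (v_ge0 w).
have wj0 : w 0 j != 0.
  apply: contraNneq w0 => wj0; apply/eqP/rowP => i; rewrite mxE; apply/eqP.
  rewrite -(absval_eq0 v) eq_le absval_ge0 andbT.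
  have <- : v (w 0 j) = 0 by apply/eqP; rewrite absval_eq0 wj0.
  by rewrite -jP; exact: (Order.TotalTheory.le_bigmax _ (fun i => v (w 0 i))).
have vwj0 : v (w 0 j) != 0 by rewrite absval_eq0.
exists ((w 0 j)^-1 *: w); apply/andP; split.
  rewrite lw eqEsubv -!memvE; apply/andP; split; last exact: memvZ (memv_line w).
  by apply/vlineP; exists (w 0 j); rewrite scalerA divff // scale1r.
have v1 : v 1 = 1.
  apply: (mulfI vwj0); by rewrite -absvalM !mulr1.
have scale1 : v (((w 0 j)^-1 *: w) 0 j) = 1 by rewrite mxE mulVf.
rewrite /sup_norm eq_le; apply/andP; split; last first.
  rewrite -[X in X <= _]scale1.
  exact: (Order.TotalTheory.le_bigmax _ (fun i => v (((w 0 j)^-1 *: w) 0 i))).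
apply: bigmax_le => // i _; rewrite mxE absvalM.
rewrite -v1 -(mulVf wj0) absvalM; apply: ler_wpM2l; first exact: absval_ge0.
by rewrite -jP; exact: (Order.TotalTheory.le_bigmax _ (fun i => v (w 0 i))).
Qed.

Definition normalized_coords (R : realType) (K : fieldType)
    (v : nonarch_absval R K) (N : nat) (x : proj_space K N) : 'rV[K]_N.+1 :=
  xchoose (normalized_coords_exist v x).

(* The value does not depend on the normalised coordinates chosen: two choices
   differ by a scalar of absolute value 1 and the H i are homogeneous. *)
Definition dist_to (R : realType) (K : fieldType) (v : nonarch_absval R K)
    (N m : nat) (H : 'I_m -> {mpoly K[N.+1]}) (y : proj_space K N) : R :=
  \big[Num.max/0]_(i < m) v (mpeval (H i) (normalized_coords v y)).

(* Main.v *)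
(* Let O, m and k be the valuation ring of C_p, its
   maximal ideal and its residue field, let pi be p or p', whichever is larger,
   and let u_i be normalised coordinates of b_i.  Call t in C_p Teichmuller if
   t^(p^l) = t for some l > 0; these elements represent k, an algebraic
   extension of F_p.  If h has Teichmuller coefficients fixed by t -> t^(q^e),
   then h o F^e = h^(q^e) mod pi.  Hence |h(u_i)| > |pi| forces |h(u_(i+ej))|
   to tend to 1 with j, while |h(u_i)| <= |pi| for all i in a progression makes
   h o F^(ej) divisible by pi up to a negligible error.

   Suppose a homogeneous f takes arbitrarily small nonzero values on the orbit.
   The polynomials that stay away from absolute value 1 along a progression of
   indices form an ideal of k[x].  As k[x] is noetherian, this ideal is maximal
   for a suitable progression on which f still takes arbitrarily small nonzero
   values, and then every h outside the ideal gets close to 1 at points where f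
   is small.  Expand f as e_1 h_1 + e_2 h_2 + ... with h_j Teichmuller and
   |e_1| > |e_2| > ...  All h_j with |e_j| > |pi| lie in the ideal, for otherwise
   f would not be small; so f(u_i) agrees with pi g(u_(i+e)) up to a unit and a
   negligible error, for an integral g.  Iterating, f(u_i) is divisible by every
   power of pi, so f vanishes on the progression, a contradiction. *)

Require Import Defs.
From mathcomp Require Import ring lra.

Set Implicit Arguments.
Unset Strict Implicit.
Unset Printing Implicit Defensive.

Import Order.TTheory GRing.Theory Num.Theory.
Local Open Scope ring_scope.

(** * Polynomials bounded for a nonarchimedean absolute value *)

Section AbsoluteValue.

Variables (R : realType) (K : fieldType) (v : nonarch_absval R K).
Implicit Types (x y : K) (r : R).

Lemma absval0 : v 0 = 0.
Proof. by apply/eqP; rewrite absval_eq0. Qed.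

Lemma absval_gt0 x : (0 < v x) = (x != 0).
Proof. by rewrite lt_def absval_ge0 andbT absval_eq0. Qed.

Lemma absval1 : v 1 = 1.
Proof.
have v1 : v 1 != 0 by rewrite absval_eq0 oner_eq0.
by apply: (mulfI v1); rewrite -absvalM !mulr1.
Qed.

Lemma absvalX x n : v (x ^+ n) = v x ^+ n.
Proof. by elim: n => [|n IHn]; rewrite ?expr0 ?absval1 // !exprS absvalM IHn. Qed.

Lemma absvalN x : v (- x) = v x.
Proof.
have vN1 : v (- 1) = 1.
  by apply: (pexpIrn (n := 2)); rewrite ?nnegrE ?absval_ge0 // -absvalX sqrrN !expr1n absval1.
by rewrite -mulN1r absvalM vN1 mul1r.
Qed.

Lemma absval_distC x y : v (x - y) = v (y - x).
Proof. by rewrite -absvalN opprB. Qed.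

Lemma absvalV x : v x^-1 = (v x)^-1.
Proof.
have [->|x0] := eqVneq x 0; first by rewrite !invr0 absval0 invr0.
have vx0 : v x != 0 by rewrite absval_eq0.
by apply: (mulfI vx0); rewrite -absvalM !divff ?absval1.
Qed.

Lemma absval_prod (I : Type) (s : seq I) (P : pred I) (F : I -> K) :
  v (\prod_(i <- s | P i) F i) = \prod_(i <- s | P i) v (F i).
Proof. by elim/big_rec2: _ => [|i y x _ <-]; rewrite ?absval1 ?absvalM. Qed.

Lemma absvalD_le r x y : v x <= r -> v y <= r -> v (x + y) <= r.
Proof. by move=> xr yr; apply: le_trans (absvalD v x y) _; rewrite ge_max xr. Qed.

Lemma absvalB_le r x y : v x <= r -> v y <= r -> v (x - y) <= r.
Proof. by move=> xr yr; rewrite absvalD_le // absvalN. Qed.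

Lemma absvalD_lt r x y : v x < r -> v y < r -> v (x + y) < r.
Proof. by move=> xr yr; apply: le_lt_trans (absvalD v x y) _; rewrite gt_max xr. Qed.

Lemma absvalB_lt r x y : v x < r -> v y < r -> v (x - y) < r.
Proof. by move=> xr yr; rewrite absvalD_lt // absvalN. Qed.

Lemma absval_dist_lt r x y z : v (x - y) < r -> v (y - z) < r -> v (x - z) < r.
Proof. by move=> xy yz; rewrite -(subrKA y) absvalD_lt. Qed.

Lemma absval_sum_le r (I : Type) (s : seq I) (P : pred I) (F : I -> K) :
  0 <= r -> (forall i, P i -> v (F i) <= r) -> v (\sum_(i <- s | P i) F i) <= r.
Proof.
move=> r0 Fr; elim/big_rec: _ => [|i x Pi xr]; first by rewrite absval0.
by rewrite absvalD_le ?Fr.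
Qed.

Lemma absval_sum_lt r (I : Type) (s : seq I) (P : pred I) (F : I -> K) :
  0 < r -> (forall i, P i -> v (F i) < r) -> v (\sum_(i <- s | P i) F i) < r.
Proof.
move=> r0 Fr; elim/big_rec: _ => [|i x Pi xr]; first by rewrite absval0.
by rewrite absvalD_lt ?Fr.
Qed.

Lemma absval_nat_le1 n : v n%:R <= 1.
Proof.
elim: n => [|n IHn]; first by rewrite absval0 ler01.
by rewrite -[n.+1]addn1 natrD absvalD_le ?absval1.
Qed.

Lemma absval_int_le1 (z : int) : v z%:~R <= 1.
Proof.
case: z => n; first exact: absval_nat_le1.
by rewrite NegzE mulrNz absvalN absval_nat_le1.
Qed.

Lemma absvalM_le1 r x y : 0 <= r -> v x <= 1 -> v y <= r -> v (x * y) <= r.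
Proof. by move=> r0 x1 yr; rewrite absvalM -[r]mul1r ler_pM ?absval_ge0. Qed.

Lemma absvalM_lt1 r x y : v x <= 1 -> v y < r -> v (x * y) < r.
Proof.
move=> x1 yr; rewrite absvalM; apply: le_lt_trans yr.
by rewrite ler_piMl ?absval_ge0.
Qed.

Lemma absvalD_eqr x y : v x < v y -> v (x + y) = v y.
Proof.
move=> xy; apply/eqP; rewrite eq_le absvalD_le ?(ltW xy) //=.
rewrite leNgt; apply/negP => lt_y.
by have := absvalB_lt lt_y xy; rewrite addrC addKr ltxx.
Qed.

Lemma absval_lt_transfer r x y : v x <= r -> r < v y -> r < v (x + y).
Proof. by move=> xr ry; rewrite absvalD_eqr // (le_lt_trans xr). Qed.

End AbsoluteValue.

Section BoundedPolynomials.

Variables (R : realType) (K : fieldType) (v : nonarch_absval R K).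

(* Gauss norm at most [r], without assuming [0 <= r]. *)
Definition mbnd n r (h : {mpoly K[n]}) : Prop := forall m, v h@_m <= r.

Section Arity.
Variable n : nat.
Implicit Types (r s : R) (g h : {mpoly K[n]}).

Lemma mbnd_le r s h : r <= s -> mbnd r h -> mbnd s h.
Proof. by move=> rs hr m; apply: le_trans (hr m) rs. Qed.

Lemma mbnd0 r : 0 <= r -> mbnd r (0 : {mpoly K[n]}).
Proof. by move=> r0 m; rewrite mcoeff0 absval0. Qed.

Lemma mbndD r g h : mbnd r g -> mbnd r h -> mbnd r (g + h).
Proof. by move=> gr hr m; rewrite mcoeffD absvalD_le. Qed.

Lemma mbndN r h : mbnd r h -> mbnd r (- h).
Proof. by move=> hr m; rewrite mcoeffN absvalN. Qed.

Lemma mbndB r g h : mbnd r g -> mbnd r h -> mbnd r (g - h).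
Proof. by move=> gr hr; apply/mbndD/mbndN. Qed.

Lemma mbnd_sum r (I : Type) (s : seq I) (P : pred I) (F : I -> {mpoly K[n]}) :
  0 <= r -> (forall i, P i -> mbnd r (F i)) -> mbnd r (\sum_(i <- s | P i) F i).
Proof.
move=> r0 Fr; elim/big_rec: _ => [|i x Pi xr]; first exact: mbnd0.
by apply: mbndD => //; apply: Fr.
Qed.

Lemma mbndM r s g h : 0 <= r -> 0 <= s -> mbnd r g -> mbnd s h -> mbnd (r * s) (g * h).
Proof.
move=> r0 s0 gr hs m; rewrite mcoeffM.
apply: absval_sum_le => [|k _]; first exact: mulr_ge0.
by rewrite absvalM ler_pM ?absval_ge0.
Qed.

Lemma mbndM1l r g h : 0 <= r -> mbnd 1 g -> mbnd r h -> mbnd r (g * h).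
Proof. by move=> r0 gr hr; rewrite -[r]mul1r; apply: mbndM. Qed.

Lemma mbndM1r r g h : 0 <= r -> mbnd r g -> mbnd 1 h -> mbnd r (g * h).
Proof. by move=> r0 gr hr; rewrite mulrC; apply: mbndM1l. Qed.

Lemma mbndZ r s c h : v c <= r -> 0 <= s -> mbnd s h -> mbnd (r * s) (c *: h).
Proof. by move=> cr s0 hs m; rewrite mcoeffZ absvalM ler_pM ?absval_ge0. Qed.

Lemma mbndZ1 r c h : 0 <= r -> v c <= 1 -> mbnd r h -> mbnd r (c *: h).
Proof. by move=> r0 c1 hr; rewrite -[r]mul1r; apply: mbndZ. Qed.

Lemma mbndX m : mbnd 1 ('X_[m] : {mpoly K[n]}).
Proof. by move=> k; rewrite mcoeffX absval_nat_le1. Qed.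

Lemma mbnd1 : mbnd 1 (1 : {mpoly K[n]}).
Proof. by rewrite -mpolyX0; apply: mbndX. Qed.

Lemma mbnd_exp h k : mbnd 1 h -> mbnd 1 (h ^+ k).
Proof.
move=> h1; elim: k => [|k IHk]; first exact: mbnd1.
by rewrite exprS; apply: mbndM1l.
Qed.

Lemma mbnd_prod (I : Type) (s : seq I) (P : pred I) (F : I -> {mpoly K[n]}) :
  (forall i, P i -> mbnd 1 (F i)) -> mbnd 1 (\prod_(i <- s | P i) F i).
Proof.
move=> F1; elim/big_rec: _ => [|i x Pi x1]; first exact: mbnd1.
by apply: mbndM1l => //; apply: F1.
Qed.

Lemma meval_le r h (u : 'I_n -> K) :
  0 <= r -> mbnd r h -> (forall i, v (u i) <= 1) -> v h.@[u] <= r.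
Proof.
move=> r0 hr u1; rewrite mevalE; apply: absval_sum_le => // m _.
rewrite mulrC absvalM_le1 // absval_prod prodr_ile1 // => i _.
by rewrite absval_ge0 absvalX exprn_ile1 ?absval_ge0 ?u1.
Qed.

End Arity.

Lemma mbnd_comp n k r (h : {mpoly K[n]}) (G : n.-tuple {mpoly K[k]}) :
  0 <= r -> mbnd r h -> (forall i, mbnd 1 (tnth G i)) -> mbnd r (h \mPo G).
Proof.
move=> r0 hr G1; rewrite comp_mpolyE; apply: mbnd_sum => // m _.
rewrite -[r]mulr1; apply: mbndZ => //; apply: mbnd_prod => i _.
by apply: mbnd_exp; apply: G1.
Qed.

(** * Congruences modulo [w] and the Frobenius map *)

Section Congruences.

Variables (n : nat) (w : R).
Hypothesis w0 : 0 <= w.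
Implicit Types (A B C D : {mpoly K[n]}).

Lemma mbnd_trans A B C : mbnd w (A - B) -> mbnd w (B - C) -> mbnd w (A - C).
Proof. by move=> AB BC; rewrite -(subrKA B); apply: mbndD. Qed.

Lemma mbnd_congM A B C D : mbnd 1 A -> mbnd 1 D ->
  mbnd w (A - B) -> mbnd w (C - D) -> mbnd w (A * C - B * D).
Proof.
move=> A1 D1 AB CD.
have -> : A * C - B * D = A * (C - D) + (A - B) * D.
  by rewrite mulrBr mulrBl addrA subrK.
by apply: mbndD; [apply: mbndM1l | apply: mbndM1r].
Qed.

Lemma mbnd_congX A B k : mbnd 1 A -> mbnd 1 B ->
  mbnd w (A - B) -> mbnd w (A ^+ k - B ^+ k).
Proof.
move=> A1 B1 AB; elim: k => [|k IHk]; first by rewrite subrr; apply: mbnd0.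
by rewrite !exprS; apply: mbnd_congM => //; apply: mbnd_exp.
Qed.

Lemma mbnd_cong_prod (I : Type) (s : seq I) (F G : I -> {mpoly K[n]}) :
  (forall i, mbnd 1 (F i)) -> (forall i, mbnd 1 (G i)) ->
  (forall i, mbnd w (F i - G i)) ->
  mbnd w (\prod_(i <- s) F i - \prod_(i <- s) G i).
Proof.
move=> F1 G1 FG; elim: s => [|i s IHs]; first by rewrite !big_nil subrr; apply: mbnd0.
by rewrite !big_cons; apply: mbnd_congM => //; apply: mbnd_prod => j _; apply: G1.
Qed.

Variable p : nat.
Hypotheses (pr_p : prime p) (vp : v p%:R <= w).

(** The inner binomial coefficients of a [p]-th power are multiples of [p], hence at most [w] in
    absolute value; exponent [p ^ e] follows by induction, since powers preserve congruences. *)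
Lemma mbnd_frobD A B e : mbnd 1 A -> mbnd 1 B ->
  mbnd w ((A + B) ^+ (p ^ e) - (A ^+ (p ^ e) + B ^+ (p ^ e))).
Proof.
have frob1 C D : mbnd 1 C -> mbnd 1 D -> mbnd w ((C + D) ^+ p - (C ^+ p + D ^+ p)).
  move=> C1 D1; case: p pr_p vp => [//|k] pr_k vk.
  rewrite exprDn big_ord_recl big_ord_recr /= subn0 subnn !expr0 bin0 binn.
  rewrite mulr1 mul1r !mulr1n opprD addrACA subrr add0r addrK.
  apply: mbnd_sum => // i _; set c := _ * _.
  rewrite -(divnK (prime_dvd_bin pr_k (_ : 0 < lift ord0 (widen_ord (leqnSn k) i) < k.+1)%N)).
    rewrite mulrnA -scaler_nat; rewrite -[w]mulr1; apply: mbndZ => //.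
    rewrite -scaler_nat -[1]mulr1; apply: mbndZ => //; first exact: absval_nat_le1.
    by rewrite /c -[1]mulr1; apply: mbndM => //; apply: mbnd_exp.
  by rewrite /= /bump leq0n add1n ltnS ltn_ord.
move=> A1 B1; elim: e => [|e IHe].
  by rewrite expn0 !expr1 subrr; apply: mbnd0.
rewrite expnSr !exprM.
have Ae : mbnd 1 (A ^+ (p ^ e)) by apply: mbnd_exp.
have Be : mbnd 1 (B ^+ (p ^ e)) by apply: mbnd_exp.
apply: (@mbnd_trans _ ((A ^+ (p ^ e) + B ^+ (p ^ e)) ^+ p)); last exact: frob1.
by apply: mbnd_congX => //; [apply: mbnd_exp | ]; apply: mbndD.
Qed.

Lemma mbnd_frob_sum (I : Type) (s : seq I) (F : I -> {mpoly K[n]}) e :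
  (forall i, mbnd 1 (F i)) ->
  mbnd w ((\sum_(i <- s) F i) ^+ (p ^ e) - \sum_(i <- s) F i ^+ (p ^ e)).
Proof.
move=> F1; elim: s => [|i s IHs].
  by rewrite !big_nil expr0n expn_eq0 (gtn_eqF (prime_gt0 pr_p)) subr0; apply: mbnd0.
rewrite !big_cons.
apply: mbnd_trans (@mbnd_frobD _ _ e (F1 i) _) _; first exact: mbnd_sum.
by rewrite opprD addrACA subrr add0r.
Qed.

End Congruences.

(** Scalars are viewed as constant polynomials in no variables, and the additive congruence is
    applied to [(x - y) + y], which avoids the sign of [(- y) ^+ (p ^ e)]. *)
Lemma absval_frobB (w : R) (p : nat) (x y : K) e :
  0 <= w -> prime p -> v p%:R <= w -> v x <= 1 -> v y <= 1 ->
  v ((x - y) ^+ (p ^ e) - (x ^+ (p ^ e) - y ^+ (p ^ e))) <= w.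
Proof.
move=> w0 pr_p vp x1 y1.
have C1 (z : K) : v z <= 1 -> mbnd 1 (z%:MP : {mpoly K[0]}).
  move=> z1 m; rewrite mcoeffC; case: (m == _); rewrite ?mulr1 ?mulr0 ?absval0 //.
have := @mbnd_frobD 0 w w0 p pr_p vp _ _ e (C1 _ (_ : v (x - y) <= 1)) (C1 _ y1).
move/(_ (absvalB_le x1 y1) 0%MM).
rewrite -mpolyCD subrK -!rmorphXn -mpolyCD -mpolyCB mcoeffC eqxx mulr1 /= => le_w.
have -> : (x - y) ^+ (p ^ e) - (x ^+ (p ^ e) - y ^+ (p ^ e)) =
  - (x ^+ (p ^ e) - ((x - y) ^+ (p ^ e) + y ^+ (p ^ e))) by ring.
by rewrite absvalN.
Qed.

End BoundedPolynomials.

(** * Teichmuller elements of C_p *)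

Definition teich (p : nat) (K : fieldType) (t : K) : Prop :=
  exists2 l, (0 < l)%N & t ^+ (p ^ l) = t.

Lemma pigeonhole_nat (T : finType) (f : nat -> T) :
  exists a b, (a < b)%N /\ f a = f b.
Proof.
have /injectivePn[i [j ij fij]] : ~~ injectiveb (fun i : 'I_(#|T|).+1 => f i).
  by apply/negP => /injectiveP/leq_card; rewrite card_ord ltnn.
case: (ltngtP i j) => [lt_ij|lt_ji|/val_inj e]; first by exists i, j.
  by exists j, i.
by rewrite e eqxx in ij.
Qed.

Lemma exprn_lt1 (R : realType) (x : R) n : 0 <= x -> x ^+ n < 1 -> x < 1.
Proof. by move=> x0; apply: contraTT; rewrite -!leNgt; apply: exprn_ege1. Qed.

Lemma closed_field_split (L : fieldType) (P : {poly L}) :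
  GRing.closed_field_axiom L -> P \is monic ->
  exists s : seq L, P = \prod_(z <- s) ('X - z%:P).
Proof.
move=> closedL; have [n] := ubnP (size P); elim: n P => // n IHn P sz_P monP.
have [sz1|sz1] := eqVneq (size P) 1%N.
  exists [::]; rewrite big_nil; have /eqP/size_poly1P[c c0 Pc] := sz1.
  by move: monP; rewrite Pc monicE lead_coefC => /eqP->.
have /PreClosedField.closed_rootP[//|z Pz] := sz1.
have /factor_theorem[Q PQ] := Pz.
have monQ : Q \is monic by move: monP; rewrite PQ monicMr ?monicXsubC.
have [|s Qs] := IHn Q _ monQ.
  by move: sz_P; rewrite PQ size_Mmonic ?monicXsubC ?monic_neq0 // size_XsubC addn2.
by exists (z :: s); rewrite big_cons -Qs mulrC.
Qed.

Section Residues.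

Variables (R : realType) (p : nat).
Hypothesis pr_p : prime p.

Lemma padic_abs_nat : padic_abs R p p%:R = p%:R^-1.
Proof.
have -> : p%:R = (p%:Z)%:~R :> rat by [].
rewrite /padic_abs intr_eq0 -[_ == _]/(p == 0)%N (gtn_eqF (prime_gt0 pr_p)).
by rewrite numq_int denq_int logn1 logn_prime // eqxx.
Qed.

Lemma padic_abs_le1_denq x : padic_abs R p x <= 1 -> ~~ (p %| `|denq x|)%N.
Proof.
rewrite /padic_abs; have [->|x0] := eqVneq.
  by rewrite (_ : denq 0 = 1) // dvdn1 gtn_eqF ?prime_gt1.
apply: contraTN => pd.
have pn : ~~ (p %| `|numq x|)%N.
  apply/negP => pn; have := coprime_num_den x.
  rewrite /coprime => /eqP g1; have := dvdn_gcd p `|numq x| `|denq x|.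
  by rewrite pn pd g1 dvdn1 gtn_eqF ?prime_gt1.
rewrite -ltNge (@lognE p `|numq x|) (negPf pn) !andbF subr0 -exprnP.
by rewrite exprn_egt1 ?ltr1n ?prime_gt1 // -lt0n logn_gt0 mem_primes pr_p pd absz_gt0 denq_eq0.
Qed.

(** Integrality makes the denominator of [x] prime to [p]; Bezout gives an inverse [d'] of it modulo
    [p], and [numq x * d'] is the required integer. *)
Lemma rat_residue (Q : fieldType) (vQ : nonarch_absval R Q) (iota : {rmorphism rat -> Q}) :
  (forall x, vQ (iota x) = padic_abs R p x) ->
  forall x, vQ (iota x) <= 1 -> exists z : int, vQ (iota x - z%:~R) < 1.
Proof.
move=> isoQ x; rewrite isoQ => /padic_abs_le1_denq pd.
have vp : vQ p%:R < 1.
  by rewrite -(rmorph_nat iota) isoQ padic_abs_nat invf_lt1 ?ltr1n ?prime_gt1 // ltr0n prime_gt0.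
have d0 : (0 < `|denq x|)%N by rewrite absz_gt0 denq_eq0.
have [d' [k dk]] : exists d' k : nat, (`|denq x| * d' = k * p + 1)%N.
  case: (egcdnP p d0) => d' k e _; exists d', k.
  rewrite mulnC e; congr addn; apply/eqP.
  by rewrite -[_ == _]/(coprime _ _) coprime_sym prime_coprime.
pose d : Q := `|denq x|%:R.
have vdd' : vQ (d * d'%:R) = 1.
  rewrite -natrM dk natrD natrM absvalD_eqr ?absval1 //.
  by apply: absvalM_lt1 => //; exact: absval_nat_le1.
have d_neq0 : d != 0.
  by apply/eqP => dz; move: vdd'; rewrite dz mul0r absval0 => /eqP; rewrite eq_sym oner_eq0.
have vd : vQ d^-1 <= 1.
  rewrite absvalV invf_le1 ?absval_gt0 // -vdd' absvalM.
  by rewrite ler_piMr ?absval_ge0 ?absval_nat_le1.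
have xE : iota x = (numq x)%:~R / d.
  rewrite -[in LHS](divq_num_den x) fmorph_div !rmorph_int; congr (_ / _).
  by rewrite /d pmulrn gez0_abs.
exists (numq x * d'%:Z); rewrite xE intrM.
have -> : (numq x)%:~R / d - (numq x)%:~R * (d'%:Z)%:~R
    = (numq x)%:~R * (d^-1 * (1 - d * d'%:R)) :> Q.
  by rewrite mulrBr mulr1 mulKf // mulrBr -pmulrn.
apply: absvalM_lt1; first exact: absval_int_le1.
apply: absvalM_lt1 => //; rewrite -natrM dk natrD natrM opprD addrCA subrr addr0 absvalN.
by apply: absvalM_lt1 => //; exact: absval_nat_le1.
Qed.

Lemma completion_residue (Q : fieldType) (vQ : nonarch_absval R Q)
    (iota : {rmorphism rat -> Q}) : is_completion (padic_abs R p) vQ iota ->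
  forall a, vQ a <= 1 -> exists z : int, vQ (a - z%:~R) < 1.
Proof.
move=> [isoQ denseQ _] a a1; have [x ax] := denseQ a 1 ltr01.
have x1 : vQ (iota x) <= 1.
  by rewrite -[iota x](subKr a); apply: absvalB_le => //; exact: ltW.
have [z xz] := rat_residue isoQ x1.
by exists z; apply: absval_dist_lt ax xz.
Qed.

(** * Residues of algebraic elements *)

Section Algebraic.

Variables (Q L : fieldType) (vL : nonarch_absval R L) (QL : {rmorphism Q -> L}).
Hypotheses (vp : vL p%:R < 1)
  (resQ : forall a, vL (QL a) <= 1 -> exists z : int, vL (QL a - z%:~R) < 1).

(** An annihilating polynomial of [y] is divided by a coefficient of maximal absolute value, and its
    coefficients are then replaced by integers with the same residues; this moves the value at [y]
    by less than 1. *)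
Lemma algebraic_residue_integral y : vL y <= 1 -> algebraicOver QL y ->
  exists2 P : {poly int}, P \is monic & vL (map_poly intr P).[y] < 1.
Proof.
move=> y1 [A A0 rootA]; pose a j := vL (QL A`_j).
(* [J] is the last index of a maximal coefficient: after division all higher coefficients are below
   1, so the reduction is monic of degree [J]. *)
have [J aJ [maxJ ltJ]] : exists2 J, 0 < a J &
    (forall i, a i <= a J) /\ (forall i, (J < i)%N -> a i < a J).
  have sz_gt0 : (0 < size A)%N by rewrite size_poly_gt0.
  have [j0 _ j0P] := arg_maxP (fun i : 'I_(size A) => a i) (erefl : xpredT (Ordinal sz_gt0)).
  have a_big i : (size A <= i)%N -> a i = 0.
    by move=> le_i; rewrite /a nth_default // rmorph0 absval0.
  have maxj i : a i <= a j0.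
    have [lt_i|le_i] := ltnP i (size A); first exact: (j0P (Ordinal lt_i)).
    by rewrite a_big ?absval_ge0.
  have aj0 : 0 < a j0.
    apply: lt_le_trans (maxj (size A).-1).
    by rewrite absval_gt0 fmorph_eq0 -[A`__]/(lead_coef A) lead_coef_eq0.
  pose top i := a i == a j0.
  have [|J /eqP aJ maxJ] := @ex_maxnP top (size A) (ex_intro _ (val j0) (eqxx _)).
    by move=> i /eqP ai; rewrite leqNgt; apply/negP => /ltnW/a_big ai0; rewrite -ai ai0 ltxx in aj0.
  exists J; rewrite aJ //; split=> // i Ji; rewrite lt_neqAle maxj andbT.
  by apply/negP => /maxJ; rewrite leqNgt Ji.
have AJ0 : A`_J != 0 by rewrite -(fmorph_eq0 QL) -(absval_eq0 vL) gt_eqF.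
pose b j := A`_j / A`_J.
have b_abs j : vL (QL (b j)) = a j / a J by rewrite fmorph_div absvalM absvalV.
have /(@boolp.choice _ _ _)[z zP] : forall j, exists z : int,
    [/\ vL (QL (b j) - z%:~R) < 1, j = J -> z = 1 & (J < j)%N -> z = 0].
  move=> j; case: (ltngtP j J) => [lt_jJ|lt_Jj|->].
  - have [|z jz] := resQ (a := b j); last by exists z; split=> // e; rewrite e ltnn in lt_jJ.
    by rewrite b_abs ler_pdivrMr // mul1r.
  - exists 0; split=> // [|e]; last by rewrite e ltnn in lt_Jj.
    by rewrite subr0 b_abs ltr_pdivrMr // mul1r ltJ.
  - by exists 1; split=> //; rewrite /b divff // rmorph1 subrr absval0.
pose P := \poly_(j < J.+1) z j.
have PE j : P`_j = z j.
  by rewrite coef_poly ltnS; case: leqP => // Jj; have [_ _ ->] := zP j.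
have PJ : z J = 1 by have [_ ->] := zP J.
have sizeP : size P = J.+1 by rewrite size_poly_eq // PJ.
exists P; first by rewrite monicE lead_coefE sizeP /= PE PJ.
have rootB : \sum_(j < size A + J.+1) QL (b j) * y ^+ j = 0.
  have := rootP rootA; rewrite (@horner_coef_wide _ (size A + J.+1)); last first.
    by rewrite size_map_poly leq_addr.
  move/(congr1 (fun x => x / QL A`_J)); rewrite mul0r mulr_suml; apply: etrans.
  by apply: eq_bigr => j _; rewrite coef_map fmorph_div mulrAC.
rewrite (@horner_coef_wide _ (size A + J.+1)); last first.
  by apply: leq_trans (size_poly _ _) _; rewrite sizeP leq_addl.
rewrite -[X in vL X]subr0 -[X in vL (_ - X)]rootB -sumrB.
apply: absval_sum_lt => // j _; rewrite coef_map_id0 // PE -mulrBl mulrC.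
apply: absvalM_lt1; first by rewrite absvalX exprn_ile1 ?absval_ge0.
by rewrite absval_distC; have [] := zP j.
Qed.

(** The remainders of ['X^(p ^ k)] by [P] take finitely many values modulo [p], so two Frobenius
    powers of [y] have the same residue; injectivity of Frobenius on residues cancels the smaller
    one. *)
Lemma algebraic_residue_periodic y : vL y <= 1 -> algebraicOver QL y ->
  exists2 l, (0 < l)%N & vL (y ^+ (p ^ l) - y) < 1.
Proof.
move=> y1 /(algebraic_residue_integral y1)[P monP Py].
pose ev (A : {poly int}) := (map_poly intr A).[y].
have evB A B : ev (A - B) = ev A - ev B by rewrite /ev rmorphB hornerD hornerN.
have evM A B : ev (A * B) = ev A * ev B by rewrite /ev rmorphM hornerM.
have yX k : vL (y ^+ k) <= 1 by rewrite absvalX exprn_ile1 ?absval_ge0.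
have ev_le1 A : vL (ev A) <= 1.
  rewrite /ev horner_coef; apply: absval_sum_le => // i _.
  by rewrite coef_map_id0 // absvalM_le1 ?absval_int_le1.
pose r k := Pdiv.Ring.rmodp 'X^(p ^ k) P.
have rE k : vL (y ^+ (p ^ k) - ev (r k)) < 1.
  have -> : y ^+ (p ^ k) = ev 'X^(p ^ k) by rewrite /ev map_polyXn hornerXn.
  rewrite {1}(Pdiv.RingMonic.rdivp_eq monP 'X^(p ^ k)) -evB addrK evM.
  exact: absvalM_lt1.
have [a [b [lt_ab rab]]] :=
  pigeonhole_nat (fun k => [ffun j : 'I_(size P) => ((r k)`_j)%:~R : 'F_p]).
have r_size k : (size (r k) <= size P)%N.
  by apply: ltnW; rewrite Pdiv.Ring.ltn_rmodpN0 ?monic_neq0.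
have y_ab : vL (y ^+ (p ^ b) - y ^+ (p ^ a)) < 1.
  apply: absval_dist_lt (rE b) _; rewrite absval_distC.
  have {1}-> : y ^+ (p ^ a) = ev (r a) + (y ^+ (p ^ a) - ev (r a)) by rewrite addrC subrK.
  rewrite addrAC; apply: absvalD_lt => //.
  rewrite -evB /ev (@horner_coef_wide _ (size P)); last first.
    apply: leq_trans (size_poly _ _) _; apply: leq_trans (size_polyD _ _) _.
    by rewrite size_polyN geq_max !r_size.
  apply: absval_sum_lt => // i _; rewrite coef_map_id0 // mulrC.
  apply: absvalM_lt1 => //; rewrite coefB.
  have /dvdzP[c ->] : (p %| (r a)`_i - (r b)`_i)%Z.
    rewrite (dvdz_pcharf (pchar_Fp pr_p)) intrB subr_eq0; apply/eqP.
    by move/ffunP/(_ i): rab; rewrite !ffunE.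
  by rewrite intrM; apply: absvalM_lt1; [exact: absval_int_le1 | exact: vp].
(* The [p ^ a]-th power of [y ^+ (p ^ (b - a)) - y] differs from [y ^+ (p ^ b) - y ^+ (p ^ a)] by at
   most [vL p%:R], so it is below 1. *)
exists (b - a)%N; first by rewrite subn_gt0.
apply: (@exprn_lt1 _ _ (p ^ a)); first exact: absval_ge0.
have := absval_frobB a (absval_ge0 vL p%:R) pr_p (lexx _) (yX (p ^ (b - a))%N) y1.
rewrite -exprM -expnD subnK 1?ltnW // -absvalX => frob.
by rewrite -[X in vL X](subrK (y ^+ (p ^ b) - y ^+ (p ^ a))) absvalD_lt // (le_lt_trans frob).
Qed.

(** The product of [y - t] over the roots [t] of [X^(p^l) - X] has absolute value below 1, so some
    factor has. *)
Lemma algebraic_teich y : GRing.closed_field_axiom L -> vL y <= 1 -> algebraicOver QL y ->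
  exists2 t, teich p t & vL (y - t) < 1.
Proof.
move=> closedL y1 /(algebraic_residue_periodic y1)[l l0 yl].
have q1 : (1 < p ^ l)%N by rewrite -(exp1n l) ltn_exp2r ?prime_gt1.
pose P : {poly L} := 'X^(p ^ l) - 'X.
have monP : P \is monic.
  by rewrite monicE lead_coefDl ?lead_coefXn // size_polyN size_polyX size_polyXn ltnS.
have [s Ps] := closed_field_split closedL monP.
have /hasP[t ts yt] : has (fun t => vL (y - t) < 1) s.
  apply/negPn/negP; rewrite -all_predC => /allP far.
  have : vL P.[y] < 1 by rewrite /P hornerD hornerN hornerXn hornerX.
  rewrite Ps horner_prod absval_prod ltNge big_seq => /negP[].
  elim/big_ind: _ => // [x z x1 z1|t ts]; first by rewrite mulr_ege1.
  by rewrite hornerXsubC leNgt; exact: far.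
exists t => //; exists l => //; apply/eqP; rewrite -subr_eq0.
have : root P t by rewrite Ps root_prod_XsubC.
by rewrite /root /P hornerD hornerN hornerXn hornerX.
Qed.

End Algebraic.

Lemma Cp_absval_p (C : fieldType) (v : nonarch_absval R C) :
  is_Cp p v -> v p%:R = p%:R^-1.
Proof.
move=> [Q [vQ [ratQ [L [vL [QL [LC [[isoQ _ _] _ isoL [isoC _ _]]]]]]]]].
by rewrite -padic_abs_nat -isoQ -isoL -isoC !rmorph_nat.
Qed.

Lemma Cp_teich (C : fieldType) (v : nonarch_absval R C) (c : C) :
  is_Cp p v -> v c <= 1 -> exists2 t, teich p t & v (c - t) < 1.
Proof.
move=> Cp c1; have := Cp_absval_p Cp.
move: Cp => [Q [vQ [ratQ [L [vL [QL [LC [complQ [closedL algL] isoL [isoC denseC _]]]]]]]]] vp.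
have vLp : vL p%:R < 1.
  by rewrite -isoC rmorph_nat vp invf_lt1 ?ltr1n ?prime_gt1 // ltr0n prime_gt0.
have resQ a : vL (QL a) <= 1 -> exists z : int, vL (QL a - z%:~R) < 1.
  rewrite isoL => /(completion_residue complQ)[z az].
  by exists z; rewrite -(rmorph_int QL) -rmorphB isoL.
have [y cy] := denseC c 1 ltr01.
have y1 : vL y <= 1.
  by rewrite -isoC -[LC y](subKr c); apply: absvalB_le => //; exact: ltW.
have [t [l l0 tl] yt] := algebraic_teich vLp resQ closedL y1 (algL y).
exists (LC t); first by exists l => //; rewrite -rmorphXn tl.
by apply: absval_dist_lt cy _; rewrite -rmorphB isoC.
Qed.

End Residues.

(** * Noetherianity of the residual polynomial ring *)

Lemma seq_argmax (T : eqType) d (S : orderType d) (f : T -> S) (s : seq T) x :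
  x \in s -> exists2 y, y \in s & forall z, z \in s -> (f z <= f y)%O.
Proof.
elim: s x => // a s IHs x _; case: s IHs => [_|b s IHs].
  by exists a; rewrite ?mem_head // => z; rewrite inE => /eqP->.
have [y ys maxy] := IHs b (mem_head _ _).
have [le_a|lt_a] := leP (f a) (f y).
  by exists y => [|z]; rewrite inE ?ys ?orbT // => /predU1P[->|/maxy].
exists a => [|z]; rewrite ?mem_head // inE => /predU1P[->//|/maxy le_z].
exact: le_trans le_z (ltW lt_a).
Qed.

(** [g N] is an index from [N] on at which [a] attains its minimum over all such indices; iterating
    [g] past the previous index gives [phi]. *)
Lemma homo_subseq (a : nat -> nat) :
  exists2 phi : nat -> nat, {homo phi : i j / (i < j)%N} &
    {homo a \o phi : i j / (i <= j)%N}.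
Proof.
have /(@boolp.choice _ _ _)[g gP] : forall N, exists i,
    (N <= i)%N /\ forall j, (N <= j)%N -> (a i <= a j)%N.
  move=> N; have aN : exists c, boolp.asbool (exists2 i, (N <= i)%N & a i = c).
    by exists (a N); apply/boolp.asboolP; exists N.
  case: (ex_minnP aN) => c /boolp.asboolP[i Ni <-] minc.
  by exists i; split=> // j Nj; apply: minc; apply/boolp.asboolP; exists j.
pose phi := fix phi i := if i is i'.+1 then g (phi i').+1 else g 0%N.
exists phi.
  by apply: homo_ltn => // [? ? ?|i]; [apply: ltn_trans | have [] := gP (phi i).+1].
apply: homo_leq => // [? ? ?|[|i] /=]; first exact: leq_trans.
  by have [_] := gP 0%N; apply.
have [_] := gP (phi i).+1; apply.
have [le1 _] := gP (phi i).+1; have [le2 _] := gP (g (phi i).+1).+1.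
by apply: leq_trans le1 _; apply: ltnW.
Qed.

(** Dickson's lemma. Subsequences are extracted one variable at a time until every exponent is
    nondecreasing; any two terms then compare. *)
Lemma dickson n (f : nat -> 'X_{1..n}) : exists i j, (i < j)%N /\ (f i <= f j)%MM.
Proof.
have [phi phiP fP] : exists2 phi : nat -> nat, {homo phi : i j / (i < j)%N} &
    forall c, c \in enum 'I_n -> {homo (fun i => f (phi i) c) : i j / (i <= j)%N}.
  elim: (enum 'I_n) => [|c s [phi phiP fP]]; first by exists id.
  have [psi psiP aP] := homo_subseq (fun i => f (phi i) c).
  exists (phi \o psi) => [i j ij | c']; first exact/phiP/psiP.
  rewrite inE => /predU1P[->|/fP c's] i j ij; first exact: aP.
  by apply: c's; move: ij; rewrite leq_eqVlt => /predU1P[->|/psiP/ltnW].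
exists (phi 0%N), (phi 1%N); split; first exact: phiP.
by apply/mnm_lepP => c; apply: (fP c); rewrite ?mem_enum.
Qed.

Lemma mcoeffMX_if n (K : fieldType) (h : {mpoly K[n]}) k m :
  (h * 'X_[k])@_m = if (k <= m)%MM then h@_(m - k) else 0.
Proof.
case: ifPn => [km|nkm]; first by rewrite -{1}(submK km) addmC mcoeffMX.
apply: memN_msupp_eq0; apply: contra nkm.
by rewrite (perm_mem (msuppMX _ _)) => /mapP[m' _ ->]; rewrite lem_addr.
Qed.

Section Noetherian.

Variables (R : realType) (K : fieldType) (v : nonarch_absval R K) (n : nat).
Implicit Types (h g : {mpoly K[n]}) (J : {mpoly K[n]} -> Prop).

(* The ideals of O[x] containing m[x], i.e. the ideals of k[x], where O, m and
   k are the valuation ring, its maximal ideal and the residue field. *)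
Record residual_ideal J : Prop := ResidualIdeal {
  residual_small : forall h, (forall m, v h@_m < 1) -> J h;
  residualB : forall h g, J h -> J g -> J (h - g);
  residualM : forall h g, mbnd v 1 g -> J h -> J (h * g) }.

(** For [h] with integral coefficients, [m] is the leading monomial of the reduction of [h] to the
    residue field. *)
Definition residual_lead h (m : 'X_{1..n}) : Prop :=
  v h@_m = 1 /\ forall m', (m < m')%O -> v h@_m' < 1.

Lemma residual_lead_exists h m :
  mbnd v 1 h -> v h@_m = 1 -> exists m0, residual_lead h m0.
Proof.
move=> h1 hm; pose s := [seq m <- msupp h | v h@_m == 1].
have ms : m \in s.
  by rewrite mem_filter hm eqxx mcoeff_msupp -(absval_eq0 v) hm oner_neq0.
have [m0 m0s maxm0] : exists2 m0, m0 \in s & forall m, m \in s -> (m <= m0)%O.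
  exact: (seq_argmax id ms).
exists m0; split=> [|m' lt_m']; first by move: m0s; rewrite mem_filter => /andP[/eqP].
rewrite lt_neqAle h1 andbT; apply/negP => hm'.
have /maxm0 : m' \in s.
  by rewrite mem_filter hm' mcoeff_msupp -(absval_eq0 v) (eqP hm') oner_neq0.
by rewrite leNgt lt_m'.
Qed.

Lemma residual_leadMX h k m :
  residual_lead h m -> residual_lead (h * 'X_[k]) (k + m)%MM.
Proof.
move=> [hm h_gt]; split; first by rewrite mcoeffMX.
move=> m' lt_m'; rewrite mcoeffMX_if; case: ifP => km; last by rewrite absval0 ltr01.
by apply: h_gt; rewrite -(ltmc_add2r k) -[X in (_ < X)%O]addmC submK.
Qed.

(** Among the integral elements of [J'] outside [J], one with minimal leading monomial works: an
    element of [J] with the same leading monomial could be used to cancel it. *)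
Lemma residual_ideal_new_lead J J' h : residual_ideal J -> residual_ideal J' ->
  (forall g, J g -> J' g) -> mbnd v 1 h -> J' h -> ~ J h ->
  exists h' m, [/\ mbnd v 1 h', J' h', residual_lead h' m &
    forall g, mbnd v 1 g -> J g -> ~ residual_lead g m].
Proof.
move=> idJ idJ' JJ'.
have has_lead g : mbnd v 1 g -> ~ J g -> exists m, residual_lead g m.
  move=> g1 nJg; apply/boolp.not_existsP => no_lead; apply/nJg/(residual_small idJ) => m.
  rewrite lt_neqAle g1 andbT; apply/eqP => gm.
  by have [m0 /no_lead] := residual_lead_exists g1 gm.
move=> h1 J'h nJh; have [m] := has_lead h h1 nJh.
move: m h h1 J'h nJh; apply: ltmwf => m IHm h h1 J'h nJh h_lead.
apply: boolp.contrapT => no_new.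
have [g [g1 Jg g_lead]] : exists g, [/\ mbnd v 1 g, J g & residual_lead g m].
  apply: boolp.contrapT => no_g; apply: no_new; exists h, m; split=> // g g1 Jg g_lead.
  by apply: no_g; exists g.
pose c := h@_m / g@_m; have [[hm h_gt] [gm g_gt]] := (h_lead, g_lead).
have g0 : g@_m != 0 by rewrite -(absval_eq0 v) gm oner_neq0.
have vc : v c = 1 by rewrite absvalM absvalV hm gm divr1.
have cg1 : mbnd v 1 (c *: g) by apply: mbndZ1; rewrite ?vc.
have Jcg : J (c *: g).
  rewrite -mul_mpolyC mulrC; apply: residualM => // m'.
  rewrite mcoeffC; case: (m' == _); rewrite ?mulr1 ?vc // mulr0 absval0 ler01.
  by [].
have h'1 : mbnd v 1 (h - c *: g) by apply: mbndB.
have nJh' : ~ J (h - c *: g).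
  (* Ideals are axiomatised by differences, so [h] is recovered as [(h - c *: g) - (0 - c *: g)]. *)
  move=> Jh'; apply: nJh; rewrite -(subrK (c *: g) h) -[X in _ + X]opprK.
  by apply: (residualB idJ) => //; rewrite -sub0r; apply: (residualB idJ) => //;
     apply: (residual_small idJ) => m'; rewrite mcoeff0 absval0 ltr01.
have J'h' : J' (h - c *: g) by apply: (residualB idJ') => //; apply: JJ'.
have [m' h'_lead] := has_lead _ h'1 nJh'.
apply: no_new; apply: (IHm m' _ _ h'1 J'h' nJh' h'_lead).
(* The leading monomial drops: the coefficient at [m] cancels, and beyond [m] both terms are
   small. *)
rewrite ltNge; apply/negP; rewrite le_eqVlt => /predU1P[mm'|lt_m].
  move: h'_lead => [+ _]; rewrite -mm' mcoeffB mcoeffZ /c divfK // subrr absval0.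
  by move/eqP; rewrite eq_sym oner_eq0.
have : v (h - c *: g)@_m' < 1.
  rewrite mcoeffB mcoeffZ; apply: absvalB_lt; first exact: h_gt.
  by apply: absvalM_lt1; rewrite ?vc ?g_gt.
by have [-> _] := h'_lead; rewrite ltxx.
Qed.

(** A strictly increasing chain would give a new leading monomial at each stage. By Dickson's lemma
    one of them divides a later one, so the later one is already the leading monomial of a multiple
    of an earlier element. *)
Lemma residual_noetherian (J : nat -> {mpoly K[n]} -> Prop) :
  (forall k, residual_ideal (J k)) -> (forall k h, J k h -> J k.+1 h) ->
  exists k, forall h, mbnd v 1 h -> J k.+1 h -> J k h.
Proof.
move=> idJ subJ; apply: boolp.contrapT => /boolp.forallNP strictJ.
have /(@boolp.choice _ _ _)[hm hmP] : forall k, exists hm : {mpoly K[n]} * 'X_{1..n},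
    [/\ mbnd v 1 hm.1, J k.+1 hm.1, residual_lead hm.1 hm.2 &
      forall g, mbnd v 1 g -> J k g -> ~ residual_lead g hm.2].
  move=> k; have /boolp.existsNP[h] := strictJ k.
  move=> /boolp.not_implyP[h1 /boolp.not_implyP[Jh nJh]].
  have [h' [m ?]] := residual_ideal_new_lead (idJ k) (idJ k.+1) (@subJ k) h1 Jh nJh.
  by exists (h', m).
have [i [j [lt_ij le_ij]]] := dickson (fun k => (hm k).2).
have [hi1 Jhi hi_lead _] := hmP i; have [_ _ _ no_lead] := hmP j.
pose X : {mpoly K[n]} := 'X_[(hm j).2 - (hm i).2].
apply: (no_lead ((hm i).1 * X)).
- by apply: mbndM1l => //; apply: mbndX.
- apply: (residualM (idJ j)); first exact: mbndX.
  have le_J a b : (a <= b)%N -> forall h, J a h -> J b h.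
    by move/subnK <-; elim: (b - a)%N => // d IHd h /IHd/subJ.
  exact: le_J Jhi.
- by rewrite -(submK le_ij); apply: residual_leadMX.
Qed.

End Noetherian.

(** * Teichmuller expansions *)

Section RealPowers.

Variable R : realType.
Implicit Types (r x y : R).

Lemma expr_lt_small r x : 0 <= r < 1 -> 0 < x -> exists k, r ^+ k < x.
Proof.
move=> /andP[r0 r1] x0; have [->|r_neq0] := eqVneq r 0.
  by exists 1%N; rewrite expr1.
have rpos : 0 < r by rewrite lt_def r_neq0.
have y0 : 0 < r^-1 - 1 by rewrite subr_gt0 invf_gt1.
have bernoulli k : 1 + (r^-1 - 1) *+ k <= r^-1 ^+ k.
  elim: k => [|k IHk]; first by rewrite mulr0n addr0 expr0.
  rewrite exprSr; apply: le_trans (_ : r^-1 ^+ k + (r^-1 - 1) <= _).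
    by rewrite mulrSr addrA lerD2r.
  have k1 : 1 <= r^-1 ^+ k by rewrite exprn_ege1 // ltW // invf_gt1.
  rewrite -subr_ge0; have -> : r^-1 ^+ k * r^-1 - (r^-1 ^+ k + (r^-1 - 1)) =
    (r^-1 ^+ k - 1) * (r^-1 - 1) by ring.
  by rewrite mulr_ge0 ?subr_ge0 // -subr_ge0 ltW.
(* Bernoulli's inequality for [r^-1] with this [k] gives [r^-1 ^+ k > x^-1]. *)
pose k := Num.bound (x^-1 / (r^-1 - 1)); exists k.
have bound_k : x^-1 / (r^-1 - 1) < k%:R.
  by apply: archi_boundP; rewrite divr_ge0 ?invr_ge0 ?(ltW x0) ?(ltW y0).
rewrite -ltf_pV2 ?posrE ?exprn_gt0 // -exprVn; apply: lt_le_trans (bernoulli k).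
by rewrite -mulr_natl -ltrBlDl (lt_trans _ (_ : x^-1 < _)) ?gtrBl ?ltr01 // -ltr_pdivrMr.
Qed.

(* Bernoulli: (1 - y) ^ k >= 1 - k y. *)
Lemma expr_le_root r x k : 0 <= x <= 1 -> x ^+ k <= r -> x <= 1 - (1 - r) / k.+1%:R.
Proof.
move=> /andP[x0 x1] xk; have bernoulli : 1 - (1 - x) *+ k.+1 <= x ^+ k.
  apply: (le_trans (y := x ^+ k.+1)); last by rewrite exprS ler_piMl // exprn_ge0.
  elim: k.+1 => [|j IHj]; first by rewrite subr0 expr0.
  rewrite exprS mulrSr; have xj : x ^+ j <= 1 by rewrite exprn_ile1.
  by have := exprn_ge0 j x0; nra.
have kpos : 0 < k.+1%:R :> R by rewrite ltr0n.
rewrite lerBrDr -lerBrDl ler_pdivrMr // mulr_natr.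
by have := le_trans bernoulli xk; lra.
Qed.

Lemma finite_lower_bound (c : nat -> R) m : (forall j, 0 < c j) ->
  exists2 c0, 0 < c0 & forall j, (j < m)%N -> c0 <= c j.
Proof.
move=> c_gt0; elim: m => [|m [c0 c00 IHm]]; first by exists 1.
exists (Num.min c0 (c m)) => [|j]; first by rewrite lt_min c00 c_gt0.
by rewrite ltnS leq_eqVlt ge_min => /predU1P[->|/IHm->//]; rewrite lexx orbT.
Qed.

End RealPowers.

(** * Coefficientwise maps, homogeneity and Gauss norms *)

Section CoefficientMap.

Variables (K : fieldType) (n : nat).
Implicit Types (tau : K -> K) (h : {mpoly K[n]}).

(** [tau] is a plain function: the maps applied later, Teichmuller lifts and power maps, need not be
    additive. *)
Definition cmap tau h : {mpoly K[n]} := \sum_(m <- msupp h) tau h@_m *: 'X_[m].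

Lemma mcoeff_cmap tau h m : tau 0 = 0 -> (cmap tau h)@_m = tau h@_m.
Proof.
move=> tau0; rewrite /cmap raddf_sum /=.
under eq_bigr => k _ do rewrite mcoeffZ mcoeffX.
have [mh|mh] := boolP (m \in msupp h).
  rewrite (bigD1_seq m) ?msupp_uniq //= eqxx mulr1 big1 ?addr0 // => k km.
  by rewrite (negPf km) mulr0.
rewrite (memN_msupp_eq0 mh) tau0 big_seq big1 // => k kh.
by have [e|] := eqVneq k m; rewrite ?mulr0 //; move: mh; rewrite -e kh.
Qed.

Lemma cmap_homog tau h d : h \is d.-homog -> cmap tau h \is d.-homog.
Proof.
move=> /dhomogP hd; rewrite /cmap big_seq; apply: rpred_sum => m mh.
by apply: dhomogZ; rewrite dhomogX; apply/eqP/hd.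
Qed.

End CoefficientMap.

Lemma comp_homog (K : fieldType) n k (h : {mpoly K[n]}) (G : n.-tuple {mpoly K[k]}) d e :
  h \is d.-homog -> (forall i, tnth G i \is e.-homog) -> h \mPo G \is (d * e).-homog.
Proof.
move=> /dhomogP hd Ge; rewrite comp_mpolyE big_seq; apply: rpred_sum => m mh.
apply: dhomogZ; have /= <- := hd _ mh; rewrite mdegE big_distrl /=.
elim/big_ind2: _ => [|d1 x1 d2 x2|i _]; [exact: dhomog1|exact: dhomogM|].
by rewrite mulnC; apply: dhomogMn.
Qed.

Lemma meval_homogZ (K : fieldType) n (h : {mpoly K[n]}) d c (u : 'I_n -> K) :
  h \is d.-homog -> h.@[fun j => c * u j] = c ^+ d * h.@[u].
Proof.
move=> /dhomogP hd; rewrite !mevalE mulr_sumr big_seq [RHS]big_seq.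
apply: eq_bigr => m mh; under eq_bigr => i _ do rewrite exprMn.
by rewrite big_split /= prodrXr -mdegE hd // mulrCA.
Qed.

Section GaussNorm.

Variables (R : realType) (K : fieldType) (v : nonarch_absval R K) (n : nat).
Implicit Types (r : R) (h : {mpoly K[n]}).

Lemma gauss_norm_ge0 h : 0 <= gauss_norm v h.
Proof. by rewrite /gauss_norm; elim/big_rec: _ => // m x _ x0; rewrite le_max x0 orbT. Qed.

Lemma mbnd_gauss_norm h : mbnd v (gauss_norm v h) h.
Proof.
move=> m; have [mh|/memN_msupp_eq0->] := boolP (m \in msupp h).
  rewrite /gauss_norm; elim: (msupp h) mh => // k s IHs.
  by rewrite inE big_cons le_max => /predU1P[->|/IHs->]; rewrite ?lexx ?orbT.
by rewrite absval0 gauss_norm_ge0.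
Qed.

Lemma gauss_norm_lt r h : 0 < r -> (forall m, v h@_m < r) -> gauss_norm v h < r.
Proof.
move=> r0 hr; rewrite /gauss_norm; elim/big_rec: _ => // m x _ xr.
by rewrite gt_max hr.
Qed.

Lemma gauss_norm_attained h : h != 0 ->
  exists2 m, m \in msupp h & forall k, v h@_k <= v h@_m.
Proof.
move=> h0; have [m mh maxm] := seq_argmax (fun m => v h@_m) (mlead_supp h0).
exists m => // k; have [/maxm//|/memN_msupp_eq0->] := boolP (k \in msupp h).
by rewrite absval0 absval_ge0.
Qed.

End GaussNorm.

Section Teichmuller.

Variables (R : realType) (p : nat) (K : fieldType) (v : nonarch_absval R K) (n : nat).
Hypothesis pr_p : prime p.
Implicit Types (t : K) (h : {mpoly K[n]}).

Lemma teich_iter t l k : t ^+ (p ^ l) = t -> t ^+ (p ^ (l * k)) = t.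
Proof.
by move=> tl; elim: k => [|k IHk]; rewrite ?muln0 ?expn0 // mulnS expnD exprM tl.
Qed.

Lemma teich_exp t k : teich p t -> teich p (t ^+ k).
Proof. by move=> [l l0 tl]; exists l => //; rewrite -exprM mulnC exprM tl. Qed.

Lemma teich0 : teich p (0 : K).
Proof. by exists 1%N => //; rewrite expr0n expn_eq0 (gtn_eqF (prime_gt0 pr_p)). Qed.

Lemma teich1 : teich p (1 : K).
Proof. by exists 1%N => //; rewrite expr1n. Qed.

Lemma teich_le1 t : teich p t -> v t <= 1.
Proof.
move=> [l l0 tl]; rewrite leNgt; apply/negP => t1.
have : v t ^+ 1 < v t ^+ (p ^ l).
  by rewrite ltr_eXn2l // -(exp1n l) ltn_exp2r ?prime_gt1.
by rewrite expr1 -absvalX tl ltxx.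
Qed.

Definition tpoly h : Prop := forall m, teich p h@_m.

Lemma tpoly_le1 h : tpoly h -> mbnd v 1 h.
Proof. by move=> th m; apply: teich_le1. Qed.

(** The product of the periods of the finitely many nonzero coefficients is a common period. *)
Lemma tpoly_period h : tpoly h ->
  exists2 l, (0 < l)%N & forall m k, (h@_m) ^+ (p ^ (l * k)) = h@_m.
Proof.
move=> th; have [l l0 hl] : exists2 l, (0 < l)%N &
    forall m, m \in msupp h -> (h@_m) ^+ (p ^ l) = h@_m.
  elim: (msupp h) => [|m s [l l0 IHs]]; first by exists 1%N.
  have [l' l'0 ml'] := th m; exists (l' * l)%N; first by rewrite muln_gt0 l'0.
  move=> m'; rewrite inE => /predU1P[->|/IHs m'l]; first exact: teich_iter.
  by rewrite mulnC; apply: teich_iter.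
exists l => // m k; have [/hl/teich_iter//|/memN_msupp_eq0->] := boolP (m \in msupp h).
by rewrite expr0n expn_eq0 (gtn_eqF (prime_gt0 pr_p)).
Qed.

Hypothesis teich_lift : forall c, v c <= 1 -> exists2 t, teich p t & v (c - t) < 1.

(** Fixing 0 keeps supports from growing, and fixing 1 makes a normalised coefficient cancel
    exactly; together they shrink the support in the expansion below. *)
Lemma teich_lift_fun : exists tau : K -> K,
  [/\ tau 0 = 0, tau 1 = 1, forall c, teich p (tau c) &
      forall c, v c <= 1 -> v (c - tau c) < 1].
Proof.
have /(@boolp.choice _ _ _)[tau tauP] : forall c, exists t,
    [/\ c = 0 -> t = 0, c = 1 -> t = 1, teich p t & v c <= 1 -> v (c - t) < 1].
  move=> c; have [->|c0] := eqVneq c 0.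
    exists 0; split=> //; first exact: teich0.
    by rewrite subr0 absval0 ltr01.
  have [->|c1] := eqVneq c 1.
    exists 1; split=> //; first exact: teich1.
    by rewrite subrr absval0 ltr01.
  have [/teich_lift[t tt ct]|c_gt1] := leP (v c) 1.
    by exists t; split=> // /eqP; rewrite (negPf c0, negPf c1).
  by exists 0; split=> [//|/eqP||//]; [rewrite (negPf c1) | exact: teich0].
exists tau; split=> [||c|c c1]; [by have [->] := tauP 0|by have [_ ->] := tauP 1| |].
  by have [_ _] := tauP c.
by have [_ _ _ ->] := tauP c.
Qed.

(* Leading term of the expansion [g = e_1 h_1 + e_2 h_2 + ...] with Teichmuller
   polynomials [h_i] and [|e_1| > |e_2| > ...].  The expansion is finite because
   [h_1] has coefficient 1 where [g] has coefficient [e_1]. *)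
Lemma teich_expansion g d : g != 0 -> g \is d.-homog ->
  exists e1 h1, [/\ e1 != 0, v e1 = gauss_norm v g, tpoly h1, h1 \is d.-homog &
    let g1 := g - e1 *: h1 in
    [/\ gauss_norm v g1 < v e1, g1 \is d.-homog &
        (size (msupp g1) < size (msupp g))%N]].
Proof.
move=> g0 gd; have [tau [tau0 tau1 tau_teich tauP]] := teich_lift_fun.
have [m0 m0g maxg] := gauss_norm_attained v g0.
have e0 : g@_m0 != 0 by rewrite -mcoeff_msupp.
exists g@_m0, (cmap tau ((g@_m0)^-1 *: g)).
have h1E m : (cmap tau ((g@_m0)^-1 *: g))@_m = tau ((g@_m0)^-1 * g@_m).
  by rewrite mcoeff_cmap // mcoeffZ.
have ve : v g@_m0 = gauss_norm v g.
  apply/eqP; rewrite eq_le mbnd_gauss_norm /= /gauss_norm.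
  elim/big_rec: _ => [|m x _ xm]; first exact: absval_ge0.
  by rewrite ge_max maxg.
have g1E m : (g - g@_m0 *: cmap tau ((g@_m0)^-1 *: g))@_m =
    g@_m0 * ((g@_m0)^-1 * g@_m - tau ((g@_m0)^-1 * g@_m)).
  by rewrite mcoeffB mcoeffZ h1E mulrBr mulVKf.
have h1d : cmap tau ((g@_m0)^-1 *: g) \is d.-homog by apply: cmap_homog; apply: dhomogZ.
split=> //; first by move=> m; rewrite h1E.
split.
- apply: gauss_norm_lt => [|m]; first by rewrite absval_gt0.
  rewrite g1E absvalM -[X in _ < X]mulr1 ltr_pM2l ?absval_gt0 //.
  by apply: tauP; rewrite absvalM absvalV ler_pdivrMl ?absval_gt0 // mulr1.
- by rewrite rpredB // dhomogZ.
- apply: (@leq_ltn_trans (size (rem m0 (msupp g)))); last first.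
    by rewrite size_rem // prednK // lt0n size_eq0 msupp_eq0.
  apply: uniq_leq_size => [|m]; first exact: msupp_uniq.
  rewrite mem_rem_uniq ?msupp_uniq // inE !mcoeff_msupp g1E => nz.
  apply/andP; split; apply: contraNneq nz.
    by move=> ->; rewrite mulVf // tau1 subrr mulr0.
  by move=> ->; rewrite mulr0 tau0 subrr mulr0.
Qed.

End Teichmuller.

(** * Values along a backward orbit *)

Section BackwardOrbit.

Variables (R : realType) (p : nat) (K : fieldType) (v : nonarch_absval R K).
Hypotheses (pr_p : prime p)
  (teich_lift : forall c, v c <= 1 -> exists2 t, teich p t & v (c - t) < 1).

Variable pi : K.
Local Notation w := (v pi).
Hypotheses (pi_neq0 : pi != 0) (w_lt1 : w < 1) (vp_le : v p%:R <= w).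

(* [G e] is the [e]-th iterate of the lift of Frobenius, and [u] a backward orbit. *)
Variables (n s : nat) (u : nat -> 'I_n -> K) (G : nat -> n.-tuple {mpoly K[n]}).
Hypotheses (s_gt0 : (0 < s)%N) (u_le1 : forall i j, v (u i j) <= 1)
  (G_homog : forall e j, tnth (G e) j \is (p ^ (s * e)).-homog)
  (G_le1 : forall e j, mbnd v 1 (tnth (G e) j))
  (G_frob : forall e j, mbnd v w (tnth (G e) j - 'X_j ^+ (p ^ (s * e))))
  (G_orbit : forall e i, exists2 c, v c = 1 &
     forall j, (tnth (G e) j).@[u (i + e)%N] = c * u i j).

Implicit Types (h g : {mpoly K[n]}).

Local Notation val i h := (v h.@[u i]).
Local Notation Q e := (p ^ (s * e))%N.

Let w_ge0 : 0 <= w := absval_ge0 v pi.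

Let w_gt0 : 0 < w. Proof. by rewrite absval_gt0. Qed.

Lemma leq_Q e : (e < Q e)%N.
Proof.
apply: (leq_trans (ltn_expl e (prime_gt1 pr_p))).
by rewrite leq_exp2l ?prime_gt1 // leq_pmull.
Qed.

Lemma val_le1 i h : mbnd v 1 h -> val i h <= 1.
Proof. by move=> h1; apply: meval_le. Qed.

Lemma meval_orbit e i h d : h \is d.-homog ->
  exists2 c, v c = 1 & (h \mPo G e).@[u (i + e)%N] = c * h.@[u i].
Proof.
move=> hd; have [c c1 cu] := G_orbit e i; exists (c ^+ d).
  by rewrite absvalX c1 expr1n.
by rewrite comp_mpoly_meval -(meval_homogZ c (u i) hd); apply: meval_eq => j; apply: cu.
Qed.

(** The Frobenius twist of [h]: since [G e] is the [Q e]-th power map modulo [pi], the twist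
    composed with [G e] is congruent to [h ^+ Q e]. *)
Definition twist e h := cmap (fun c => c ^+ Q e) h.

Lemma expr0Q e : (0 : K) ^+ Q e = 0.
Proof. by rewrite expr0n expn_eq0 (gtn_eqF (prime_gt0 pr_p)). Qed.

Lemma mcoeff_twist e h m : (twist e h)@_m = (h@_m) ^+ Q e.
Proof. by rewrite mcoeff_cmap ?expr0Q. Qed.

Lemma twist_tpoly e h : tpoly p h -> tpoly p (twist e h).
Proof. by move=> th m; rewrite mcoeff_twist; apply: teich_exp. Qed.

(** Both sides are congruent to the sum of the [Q e]-th powers of the terms of [h], one because
    [G e] lifts Frobenius, the other because Frobenius is additive modulo [p]. *)
Lemma twist_frob e h : mbnd v 1 h -> mbnd v w (twist e h \mPo G e - h ^+ Q e).
Proof.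
move=> h1; apply: (@mbnd_trans _ _ v _ _ _ (\sum_(m <- msupp h) ((h@_m *: 'X_[m]) ^+ Q e))).
  rewrite /twist /cmap raddf_sum -sumrB /=; apply: mbnd_sum => // m _.
  rewrite comp_mpolyZ exprZn -scalerBr -[w]mul1r.
  apply: mbndZ => //; first by rewrite absvalX exprn_ile1 ?absval_ge0.
  have -> : 'X_[m] ^+ Q e = \prod_(j < n) ('X_j ^+ Q e) ^+ (m j) :> {mpoly K[n]}.
    rewrite mpolyXE_id -prodrXl; apply: eq_bigr => j _; exact: exprAC.
  rewrite comp_mpolyX; apply: mbnd_cong_prod => // j.
  - by apply: mbnd_exp.
  - by apply/mbnd_exp/mbnd_exp/mbndX.
  - by apply: mbnd_congX => //; apply/mbnd_exp/mbndX.
have {3}-> : h = \sum_(m <- msupp h) h@_m *: 'X_[m] by exact: mpolyE.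
rewrite -opprB; apply/mbndN/mbnd_frob_sum => // m.
by apply: mbndZ1 => //; apply: mbndX.
Qed.

(** The two quantities are absolute values of elements at distance at most [w]; once either exceeds
    [w], the ultrametric inequality makes them equal. *)
Lemma val_twist e i h d : h \is d.-homog -> mbnd v 1 h ->
  w < val i (twist e h) \/ w < val (i + e)%N h ^+ Q e ->
  val i (twist e h) = val (i + e)%N h ^+ Q e.
Proof.
move=> hd h1; have [c c1 ch] := meval_orbit e i (cmap_homog (fun c => c ^+ Q e) hd).
have := meval_le w_ge0 (twist_frob e h1) (u_le1 (i + e)%N).
rewrite mevalB ch rmorphXn /= -absvalX.
have <- : v (c * (twist e h).@[u i]) = val i (twist e h) by rewrite absvalM c1 mul1r.
set x := _ * _; set y := _ ^+ _ => xy [wx|wy].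
  have := absvalD_eqr (le_lt_trans _ wx : v (y - x) < v x).
  by rewrite subrK absval_distC => ->.
by have := absvalD_eqr (le_lt_trans xy wy); rewrite subrK.
Qed.

Definition periodic l h : Prop := forall m k, (h@_m) ^+ (p ^ (l * k)) = h@_m.

Lemma twist_periodic l e h : periodic l h -> (l %| e)%N -> twist e h = h.
Proof.
move=> per /dvdnP[k ->]; apply/mpolyP => m.
by rewrite mcoeff_twist mulnA mulnC per.
Qed.

(** As [h] is its own twist, [val i h] is the [Q k]-th power of [val (i + k) h]; a value at most [r]
    there would push [val i h] below [w] once [r ^+ Q k < w]. *)
Lemma val_grows l h d i : h \is d.-homog -> mbnd v 1 h -> periodic l h ->
  w < val i h -> forall r, r < 1 -> exists k0, forall k, (k0 <= k)%N ->
  (l %| k)%N -> r < val (i + k)%N h.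
Proof.
move=> hd h1 per wh r r1.
have [r0|r0] := ltP r 0; first by exists 0%N => k _ _; apply: lt_le_trans r0 (absval_ge0 _ _).
have [k0 rk0] := expr_lt_small (introT andP (conj r0 r1)) w_gt0.
exists k0 => k k0k lk; rewrite ltNge; apply/negP => le_r.
have := val_twist (e := k) (i := i) hd h1; rewrite (twist_periodic per lk) => /(_ (or_introl wh)) e.
have : val i h < w.
  rewrite e; apply: le_lt_trans rk0; apply: (le_trans (y := r ^+ Q k)).
    by apply: lerXn2r; rewrite ?nnegrE ?absval_ge0.
  by apply: ler_wiXn2l; rewrite ?(ltW r1) // (leq_trans k0k) // ltnW // leq_Q.
by rewrite ltNge (ltW wh).
Qed.

(** Only the tail of the progression counts, so passing to a subprogression can only enlarge the
    ideal. *)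
Definition null i l h : Prop := exists2 r, r < 1 &
  exists k0, forall k, (k0 <= k)%N -> val (i + k * l)%N h <= r.

Lemma null_ideal i l : residual_ideal v (null i l).
Proof.
split=> [h h_lt1|h g [r r1 [k0 hr]] [r' r'1 [k0' gr']]|h g g1 [r r1 [k0 hr]]].
- exists (gauss_norm v h); first exact: gauss_norm_lt.
  by exists 0%N => k _; apply: meval_le => //; [exact: gauss_norm_ge0 | exact: mbnd_gauss_norm].
- exists (Num.max r r'); first by rewrite gt_max r1.
  exists (maxn k0 k0') => k; rewrite geq_max => /andP[k0k k0'k].
  by rewrite mevalB; apply: absvalB_le; rewrite le_max ?hr ?gr' ?orbT.
- exists r => //; exists k0 => k k0k; rewrite mevalM mulrC.
  apply: absvalM_le1; [|exact: val_le1|exact: hr].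
  exact: le_trans (absval_ge0 _ _) (hr k k0k).
Qed.

Lemma null_refine i l j m h : (0 < m)%N -> null i l h -> null (i + j * l)%N (l * m)%N h.
Proof.
move=> m0 [r r1 [k0 hr]]; exists r => //; exists k0 => k k0k.
have -> : (i + j * l + k * (l * m) = i + (j + k * m) * l)%N by ring.
by apply: hr; apply: leq_trans k0k _; apply: leq_trans (leq_addl _ _); rewrite leq_pmulr.
Qed.

(** * Progressions on which [f] takes arbitrarily small nonzero values *)

Variables (f : {mpoly K[n]}) (df : nat).
Hypotheses (f_homog : f \is df.-homog) (f_le1 : mbnd v 1 f).

Definition good i l : Prop := forall c : R, 0 < c ->
  exists k, f.@[u (i + k * l)%N] != 0 /\ val (i + k * l)%N f <= c.

(** A progression is the union of [m] subprogressions; if each had a lower bound for nonzero values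
    of [f], the least of them would serve for the whole. *)
Lemma good_refine i l m : good i l -> (0 < m)%N -> exists j, good (i + j * l)%N (l * m)%N.
Proof.
move=> g m0; apply: boolp.contrapT => /boolp.forallNP no.
have /(@boolp.choice _ _ _)[c cP] : forall j, exists c : R, 0 < c /\
    forall k, ~ (f.@[u (i + j * l + k * (l * m))%N] != 0 /\
                 val (i + j * l + k * (l * m))%N f <= c).
  move=> j; have /boolp.existsNP[c /boolp.not_implyP[c0 cP]] := no j.
  by exists c; split=> // k fk; apply: cP; exists k.
have [c0 c0_gt0 c0_le] := finite_lower_bound m (fun j => (cP j).1).
have [k [fk fkc]] := g c0 c0_gt0.
apply: (cP (k %% m)%N).2 (k %/ m)%N _.
have -> : (i + k %% m * l + k %/ m * (l * m) = i + k * l)%N.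
  by rewrite {3}(divn_eq k m); ring.
by split=> //; apply: le_trans fkc (c0_le _ _); rewrite ltn_mod.
Qed.

Lemma good_large i l c N : good i l -> 0 < c ->
  exists2 k, (N <= k)%N & val (i + k * l)%N f <= c.
Proof.
move=> g c0.
(* Halving makes [b k] strictly smaller than a nonzero value; the default 1 keeps it positive at
   zeros. A nonzero value below all [b k] with [k < N] must occur at index [N] or later. *)
pose b k := if f.@[u (i + k * l)%N] != 0 then val (i + k * l)%N f / 2 else 1.
have b0 k : 0 < b k.
  by rewrite /b; case: ifP => // fk; rewrite divr_gt0 ?absval_gt0.
have [c0' c0'0 c0'_le] := finite_lower_bound N b0.
have [|k [fk fkc]] := g (Num.min c c0'); first by rewrite lt_min c0.
move: fkc; rewrite le_min => /andP[fkc fkc0].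
exists k => //; rewrite leqNgt; apply/negP => /c0'_le; rewrite /b fk => le_c.
have := absval_gt0 v f.@[u (i + k * l)%N]; rewrite fk => fpos.
have := le_trans fkc0 le_c; lra.
Qed.

(** Otherwise [next] iterates to a chain of good progressions with strictly increasing null ideals,
    against noetherianity. *)
Lemma good_maximal : good 0 1 -> exists i l, [/\ (0 < l)%N, good i l &
  forall j m, (0 < m)%N -> good (i + j * l)%N (l * m)%N ->
  forall h, mbnd v 1 h -> null (i + j * l)%N (l * m)%N h -> null i l h].
Proof.
move=> g01; apply: boolp.contrapT => no_max.
pose Good (x : nat * nat) := (0 < x.2)%N /\ good x.1 x.2.
have /(@boolp.choice _ _ _)[next nextP] : forall x, exists y, Good x ->
    [/\ Good y, forall h, null x.1 x.2 h -> null y.1 y.2 h &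
      exists h, [/\ mbnd v 1 h, null y.1 y.2 h & ~ null x.1 x.2 h]].
  move=> [i l]; have [[/= l0 gil]|ngx] := boolp.pselect (Good (i, l)); last by exists (i, l).
  apply: boolp.contrapT => no_next; apply: no_max; exists i, l; split=> // j m m0 g' h h1 h'.
  apply: boolp.contrapT => nh; apply: no_next; exists (i + j * l, l * m)%N => _.
  split; first by split; rewrite //= muln_gt0 l0.
    by move=> h'' /=; apply: null_refine.
  by exists h.
pose x k := iter k next (0, 1)%N.
have gx k : Good (x k) by elim: k => [|k /nextP[]].
have sub k h : null (x k).1 (x k).2 h -> null (x k.+1).1 (x k.+1).2 h.
  by have [_ sub _] := nextP _ (gx k); apply: sub.
have [k maxk] := residual_noetherian (fun k => null_ideal (x k).1 (x k).2) sub.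
have [_ _ [h [h1 h' nh]]] := nextP _ (gx k).
exact/nh/maxk.
Qed.

(** * Divisibility on a good progression with maximal null ideal *)

Section GoodProgression.

Variables (i0 L : nat).
Hypotheses (L_gt0 : (0 < L)%N) (good_i0 : good i0 L)
  (max_i0 : forall j m, (0 < m)%N -> good (i0 + j * L)%N (L * m)%N ->
   forall h, mbnd v 1 h -> null (i0 + j * L)%N (L * m)%N h -> null i0 L h).

(** On a good subprogression whose step is a multiple of the period, maximality keeps [h] from being
    null, so [h] exceeds [w] somewhere; from there its values grow past [r], and [f] is small at
    arbitrarily late indices. *)
Lemma tpoly_nonnull h d r c : tpoly p h -> h \is d.-homog -> ~ null i0 L h ->
  r < 1 -> 0 < c ->
  exists k, val (i0 + k * L)%N f <= c /\ r < val (i0 + k * L)%N h.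
Proof.
move=> th hd nh r1 c0; have h1 := tpoly_le1 v pr_p th.
have [l l0 per] := tpoly_period pr_p th.
have [j gj] := good_refine good_i0 l0.
have [k1 wk1] : exists k1, w < val (i0 + j * L + k1 * (L * l))%N h.
  apply: boolp.contrapT => /boolp.forallNP small; apply: nh.
  apply: (max_i0 l0 gj) => //; exists w => //; exists 0%N => k _.
  by rewrite leNgt; apply/negP/small.
have [k0 k0P] := val_grows hd h1 per wk1 r1.
have [k Nk fk] := good_large (k1 + k0) gj c0.
exists (j + k * l)%N.
have -> : (i0 + (j + k * l) * L = i0 + j * L + k * (L * l))%N by ring.
split=> //; have := k0P ((k - k1) * (L * l))%N.
rewrite -addnA -mulnDl subnKC; last by apply: leq_trans Nk; apply: leq_addr.
apply; last by rewrite mulnA dvdn_mull.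
apply: (@leq_trans (k - k1)); first by rewrite leq_subRL // (leq_trans _ Nk) ?leq_addr.
by rewrite leq_pmulr // muln_gt0 L_gt0.
Qed.

Lemma tpoly_null_le h d k : tpoly p h -> h \is d.-homog -> null i0 L h ->
  val (i0 + k * L)%N h <= w.
Proof.
move=> th hd [r r1 [k0 hr]]; have h1 := tpoly_le1 v pr_p th.
have [l l0 per] := tpoly_period pr_p th.
rewrite leNgt; apply/negP => wk.
have [k1 k1P] := val_grows hd h1 per wk r1.
(* Moving on by [(k0 + k1) * l] terms passes both thresholds and is a multiple of the period, so
   growth of [h] contradicts nullity. *)
have large : (k0 + k1 <= (k0 + k1) * l)%N by rewrite leq_pmulr.
have k1_le : (k1 <= (k0 + k1) * l * L)%N.
  by rewrite (leq_trans (leq_addl k0 k1)) // (leq_trans large) // leq_pmulr.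
have := k1P _ k1_le (dvdn_mulr _ (dvdn_mull _ (dvdnn l))).
rewrite -addnA -mulnDl ltNge hr //.
by rewrite (leq_trans _ (leq_addl _ _)) // (leq_trans _ large) ?leq_addr.
Qed.

(** Where [val h ^+ Q e'] exceeds [w], it equals a value of the twist [e'] steps earlier, which is
    at most [r]; hence it never exceeds [Num.max r w] far along the progression. *)
Lemma null_twist e h d : tpoly p h -> h \is d.-homog -> (L %| e)%N ->
  null i0 L (twist e h) -> null i0 L h.
Proof.
move=> th hd /dvdnP[a ->] [r r1 [k0 hr]]; have h1 := tpoly_le1 v pr_p th.
set e' := (a * L)%N in hr *.
have m1 : Num.max r w < 1 by rewrite gt_max r1.
(* An upper bound, below 1, for the [Q e']-th root of [Num.max r w]. *)
exists (1 - (1 - Num.max r w) / (Q e').+1%:R).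
  by rewrite gtrBl divr_gt0 ?ltr0n // subr_gt0.
exists (k0 + a)%N => k ak; apply: expr_le_root; first by rewrite absval_ge0 val_le1.
have ka : (k = k - a + a)%N by rewrite subnK // (leq_trans _ ak) ?leq_addl.
have -> : (i0 + k * L = i0 + (k - a) * L + e')%N by rewrite {1}ka mulnDl addnA.
rewrite leNgt; apply/negP; rewrite gt_max => /andP[r_lt w_lt].
move: r_lt; rewrite -(val_twist hd h1 (or_intror w_lt)) ltNge hr //.
by rewrite -(leq_add2r a) -ka.
Qed.

(** Applied to the twist, the previous result controls [h] at the index shifted by [e], while [f] is
    small at the unshifted one. *)
Lemma tpoly_nonnull_shift e h d r c : tpoly p h -> h \is d.-homog -> ~ null i0 L h ->
  (L %| e)%N -> r < 1 -> 0 < c ->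
  exists k, val (i0 + k * L)%N f <= c /\ r < val (i0 + k * L + e)%N h.
Proof.
move=> th hd nh Le r1 c0; have h1 := tpoly_le1 v pr_p th.
have m1 : Num.max r w < 1 by rewrite gt_max r1.
have [k [fk]] := tpoly_nonnull (twist_tpoly e th) (cmap_homog _ hd)
  (fun nt => nh (null_twist th hd Le nt)) m1 c0.
rewrite gt_max => /andP[rk wk]; exists k; split=> //.
move: rk; rewrite (val_twist hd h1 (or_introl wk)) => /lt_le_trans; apply.
rewrite -[X in _ <= X]expr1; apply: ler_wiXn2l; rewrite ?absval_ge0 ?val_le1 //.
by rewrite expn_gt0 prime_gt0.
Qed.

(** Induction on the number of monomials, peeling off the leading Teichmuller term [e1 *: h1].
    Either [g] is divisible by [pi], or [h1] is not null and dominates [g] where [f] is small, or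
    [h1] is null and only the rest [g1'] decides. *)
Lemma small_or_divisible g d : mbnd v 1 g -> g \is d.-homog ->
  (forall e c, (L %| e)%N -> 0 < c ->
     exists k, val (i0 + k * L)%N f <= c /\ w < val (i0 + k * L + e)%N g) \/
  (exists2 l, (0 < l)%N & forall e, (l %| e)%N -> exists g',
     [/\ mbnd v 1 g', g' \is (d * Q e).-homog &
      forall k, val (i0 + k * L)%N (g \mPo G e - pi *: g') <= w ^+ Q e]).
Proof.
have [N] := ubnP (size (msupp g)); elim: N g => // N IHN g sz_g g1 gd.
have vpiV : v pi^-1 * w = 1 by rewrite absvalV mulVf // absval_eq0.
have [gw|gw] := leP (gauss_norm v g) w.
  right; exists 1%N => // e _; exists (pi^-1 *: (g \mPo G e)); split.
  - rewrite -vpiV; apply: mbndZ => //; apply: mbnd_comp => //.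
    exact: mbnd_le gw (mbnd_gauss_norm v g).
  - by apply/dhomogZ/comp_homog.
  - by move=> k; rewrite scalerA divff // scale1r subrr meval0 absval0 exprn_ge0.
have g0 : g != 0.
  by apply: contraTneq gw => ->; rewrite -leNgt /gauss_norm msupp0 big_nil.
have [e1 [h1 [e1_neq0 ve1 th hd [g1_lt g1d g1_sz]]]] :=
  teich_expansion pr_p teich_lift g0 gd.
set g1' := g - e1 *: h1 in g1_lt g1d g1_sz.
have gE : g = g1' + e1 *: h1 by rewrite subrK.
have h1_le1 := tpoly_le1 v pr_p th.
have e1_le1 : v e1 <= 1.
  rewrite ve1 /gauss_norm; elim/big_rec: _ => [|m x _ x1]; first exact: ler01.
  by rewrite ge_max g1.
have e1_gt0 : 0 < v e1 by rewrite absval_gt0.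
have valE i : g.@[u i] = g1'.@[u i] + e1 * h1.@[u i] by rewrite {1}gE mevalD mevalZ.
have [null_h1|nh1] := boolp.pselect (null i0 L h1); last first.
  (* Bringing [h1] above [r / v e1] makes [e1 * h1] dominate both [g1'] and [w]. *)
  left=> e c Le c0; pose r := Num.max w (gauss_norm v g1').
  have r_lt : r / v e1 < 1 by rewrite ltr_pdivrMr // mul1r gt_max ve1 gw -ve1.
  have [k [fk rk]] := tpoly_nonnull_shift th hd nh1 Le r_lt c0.
  exists k; split=> //; rewrite valE.
  have rk' : r < v (e1 * h1.@[u (i0 + k * L + e)%N]).
    by rewrite absvalM mulrC -ltr_pdivrMr.
  apply: le_lt_trans (_ : r < _); first by rewrite le_max lexx.
  apply: absval_lt_transfer rk'; rewrite le_max; apply/orP; right.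
  exact: meval_le (gauss_norm_ge0 _ _) (mbnd_gauss_norm _ _) (u_le1 _).
have h1w k : v (e1 * h1.@[u (i0 + k * L)%N]) <= w.
  by apply: absvalM_le1 => //; apply: (tpoly_null_le _ th hd).
have g1'_le1 : mbnd v 1 g1' by apply: mbndB => //; apply: mbndZ1.
have [|div_g1'|[l l0 div_g1']] := IHN g1' _ g1'_le1 g1d.
- exact: leq_trans g1_sz sz_g.
- left=> e c Le c0; have [k [fk wk]] := div_g1' e c Le c0; exists k; split=> //.
  rewrite valE addrC; apply: absval_lt_transfer wk.
  by case/dvdnP: Le => a ->; rewrite -addnA -mulnDl.
have [l1 l10 per] := tpoly_period pr_p th.
right; exists (l * l1)%N; first by rewrite muln_gt0 l0.
move=> e le; have [g' [g'1 g'd g'P]] := div_g1' e (dvdn_trans (dvdn_mulr _ (dvdnn _)) le).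
have /(twist_periodic per) tw : (l1 %| e)%N by apply: dvdn_trans le; apply: dvdn_mull.
(* [h1 \mPo G e] is [h1 ^+ Q e] plus [pi *: h']; on the progression [h1] is at most [w], so the
   power falls within the allowed error. *)
pose h' := pi^-1 *: (h1 \mPo G e - h1 ^+ Q e).
have h'1 : mbnd v 1 h'.
  by rewrite -vpiV; apply: mbndZ => //; have := twist_frob e h1_le1; rewrite tw.
have h'd : h' \is (d * Q e).-homog.
  by rewrite dhomogZ // rpredB ?comp_homog ?dhomogMn.
exists (g' + e1 *: h'); split.
- by apply: mbndD => //; apply: mbndZ1.
- by rewrite rpredD // dhomogZ.
move=> k; have -> : g \mPo G e - pi *: (g' + e1 *: h') =
    (g1' \mPo G e - pi *: g') + e1 *: h1 ^+ Q e.
  rewrite {1}gE comp_mpolyD comp_mpolyZ scalerDr opprD addrACA; congr (_ + _).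
  by rewrite !scalerA mulrAC mulfV // mul1r -scalerBr subKr.
rewrite mevalD mevalZ rmorphXn /=; apply: absvalD_le; first exact: g'P.
apply: absvalM_le1; rewrite ?exprn_ge0 // absvalX.
by apply: lerXn2r; rewrite ?nnegrE ?absval_ge0 //; apply: (tpoly_null_le _ th hd).
Qed.

(** Induction on [M] at fixed precision [w ^+ N]. The first alternative for [g] cannot occur: with
    [f] at most [w ^+ N] and [g] above [w], the difference would exceed [w ^+ M.+1]. The second
    extracts one more factor [pi]. *)
Lemma approx_divisible N M : (M <= N)%N -> exists e g d,
  [/\ (L %| e)%N, mbnd v 1 g, g \is d.-homog & forall k, exists2 c, v c = 1 &
   v (c * f.@[u (i0 + k * L)%N] - pi ^+ M * g.@[u (i0 + k * L + e)%N]) <= w ^+ N].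
Proof.
elim: M => [_|M IHM lt_MN].
  exists 0%N, f, df; split=> // k; exists 1; first exact: absval1.
  by rewrite mul1r expr0 mul1r addn0 subrr absval0 exprn_ge0.
have [e [g [d [Le g1 gd fg]]]] := IHM (ltnW lt_MN).
have wN i : (i <= N)%N -> w ^+ N <= w ^+ i.
  by move=> iN; apply: ler_wiXn2l => //; apply: ltW.
have [large|[l l0 div_g]] := small_or_divisible g1 gd.
  have [|k [fk wk]] := large e (w ^+ N) Le; first exact: exprn_gt0.
  have [c c1 fgk] := fg k; exfalso.
  have : w ^+ M.+1 < v (c * f.@[u (i0 + k * L)%N] - pi ^+ M * g.@[u (i0 + k * L + e)%N]).
    apply: absval_lt_transfer.
      by rewrite absvalM c1 mul1r (le_trans fk) ?wN.
    by rewrite absvalN absvalM absvalX exprSr ltr_pM2l ?exprn_gt0.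
  by rewrite ltNge (le_trans fgk) ?wN.
(* The factor [l] gives divisibility, [L] keeps the index on the progression, and [N] makes the new
   error [w ^+ Q e'] at most [w ^+ N]. *)
pose e' := (l * (L * N))%N; have [g' [g'1 g'd g'P]] := div_g e' (dvdn_mulr _ (dvdnn _)).
have Le' : (L %| e')%N by rewrite /e' mulnCA dvdn_mulr.
exists (e + e')%N, g', (d * Q e')%N; split=> // [|k]; first exact: dvdn_add.
have [c c1 fgk] := fg k; have [c' c'1 gk] := meval_orbit e' (i0 + k * L + e)%N gd.
exists (c' * c); first by rewrite absvalM c1 c'1 mulr1.
have -> : c' * c * f.@[u (i0 + k * L)%N] - pi ^+ M.+1 * g'.@[u (i0 + k * L + (e + e'))%N] =
    c' * (c * f.@[u (i0 + k * L)%N] - pi ^+ M * g.@[u (i0 + k * L + e)%N]) +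
    pi ^+ M * (g \mPo G e' - pi *: g').@[u (i0 + k * L + (e + e'))%N].
  by rewrite mevalB mevalZ addnA gk exprSr; ring.
apply: absvalD_le; first by rewrite absvalM c'1 mul1r.
apply: absvalM_le1; rewrite ?exprn_ge0 ?absvalX ?exprn_ile1 ?(ltW w_lt1) //.
have -> : (i0 + k * L + (e + e') = i0 + (k + (e + e') %/ L) * L)%N.
  by rewrite mulnDl divnK ?dvdn_add // -addnA.
apply: le_trans (g'P _) _; apply: ler_wiXn2l; rewrite ?(ltW w_lt1) //.
apply: leq_trans (ltnW (leq_Q _)).
by rewrite /e' mulnA leq_pmull // muln_gt0 l0.
Qed.

(** Divisibility by [pi ^+ N] up to [w ^+ N] bounds the value by [w ^+ N], for every [N]. *)
Lemma progression_vanishing k : f.@[u (i0 + k * L)%N] = 0.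
Proof.
apply/eqP; rewrite -(absval_eq0 v) eq_le absval_ge0 andbT leNgt; apply/negP => f0.
have [N wN] := expr_lt_small (introT andP (conj w_ge0 w_lt1)) f0.
have [e [g [d [_ g1 _ fg]]]] := approx_divisible (leqnn N).
have [c c1 fgk] := fg k; move: wN; rewrite ltNge => /negP; apply.
rewrite -[X in X <= _]mul1r -c1 -absvalM -[X in v X](subrK (pi ^+ N * g.@[u (i0 + k * L + e)%N])).
apply: absvalD_le => //; rewrite absvalM absvalX ler_piMr ?exprn_ge0 //.
exact: val_le1.
Qed.

End GoodProgression.

Lemma orbit_gap : exists2 c, 0 < c & forall i, f.@[u i] = 0 \/ c < val i f.
Proof.
apply: boolp.contrapT => no_gap.
have g01 : good 0 1.
  move=> c c0; apply: boolp.contrapT => no_k; apply: no_gap; exists c => // i.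
  have [->|fi] := eqVneq (f.@[u i]) 0; first by left.
  right; rewrite ltNge; apply/negP => fc; apply: no_k; exists i.
  by rewrite add0n muln1.
have [i0 [L [L0 g maxg]]] := good_maximal g01.
have [k [fk _]] := g 1 ltr01.
by move: fk; rewrite progression_vanishing // eqxx.
Qed.

End BackwardOrbit.

(** * Iterates of a lift of Frobenius *)

Section FrobeniusIterates.

Variables (R : realType) (K : fieldType) (v : nonarch_absval R K) (p s n : nat).
Variables (w : R) (p' : K) (P : 'I_n -> {mpoly K[n]}).
Hypotheses (w_ge0 : 0 <= w) (w_le1 : w <= 1) (p'_le : v p' <= w)
  (P_homog : forall j, P j \is (p ^ s).-homog) (P_le1 : forall j, mbnd v 1 (P j)).

Definition frob_lift j : {mpoly K[n]} := 'X_j ^+ (p ^ s) + p' *: P j.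

Fixpoint frob_iter e : n.-tuple {mpoly K[n]} :=
  if e is e'.+1 then [tuple frob_lift j \mPo frob_iter e' | j < n]
  else [tuple 'X_j | j < n].

Lemma frob_lift_homog j : frob_lift j \is (p ^ s).-homog.
Proof.
rewrite rpredD ?dhomogZ //; have : 'X_j \is [in K[n], 1.-homog] by rewrite dhomogX /= mdeg1.
by move/(@dhomogMn _ _ _ _ _ (p ^ s)); rewrite mul1n.
Qed.

Lemma frob_lift_le1 j : mbnd v 1 (frob_lift j).
Proof.
apply: mbndD; first by apply/mbnd_exp/mbndX.
by apply: mbndZ1 => //; apply: le_trans p'_le w_le1.
Qed.

Lemma frob_iter_homog e j : tnth (frob_iter e) j \is (p ^ (s * e)).-homog.
Proof.
elim: e j => [|e IHe] j; rewrite tnth_mktuple; first by rewrite muln0 dhomogX /= mdeg1.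
by rewrite mulnS expnD; apply: comp_homog IHe; apply: frob_lift_homog.
Qed.

Lemma frob_iter_le1 e j : mbnd v 1 (tnth (frob_iter e) j).
Proof.
elim: e j => [|e IHe] j; rewrite tnth_mktuple; first exact: mbndX.
by apply: mbnd_comp => //; apply: frob_lift_le1.
Qed.

Lemma frob_iter_cong e j : mbnd v w (tnth (frob_iter e) j - 'X_j ^+ (p ^ (s * e))).
Proof.
elim: e j => [|e IHe] j; rewrite tnth_mktuple.
  by rewrite muln0 expr1 subrr; apply: mbnd0.
rewrite comp_mpolyD comp_mpolyZ rmorphXn /= comp_mpolyXU -tnth_nth addrAC.
apply: mbndD.
  rewrite mulnS expnD mulnC exprM; apply: mbnd_congX => //; first exact: frob_iter_le1.
  by apply/mbnd_exp/mbndX.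
rewrite -[w]mulr1; apply: mbndZ => //; apply: mbnd_comp => //.
exact: frob_iter_le1.
Qed.

(** Homogeneity turns a unit scalar in the argument into its [p ^ s]-th power outside, again a
    unit. *)
Lemma frob_iter_orbit (u : nat -> 'I_n -> K) :
  (forall i, exists2 c, v c = 1 & forall j, (frob_lift j).@[u i.+1] = c * u i j) ->
  forall e i, exists2 c, v c = 1 &
    forall j, (tnth (frob_iter e) j).@[u (i + e)%N] = c * u i j.
Proof.
move=> orbit1; elim=> [|e IHe] i.
  exists 1 => [|j]; first exact: absval1.
  by rewrite tnth_mktuple mevalXU addn0 mul1r.
have [c c1 cu] := IHe i.+1; have [c' c'1 c'u] := orbit1 i.
exists (c ^+ (p ^ s) * c') => [|j]; first by rewrite absvalM absvalX c1 expr1n c'1 mulr1.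
rewrite tnth_mktuple comp_mpoly_meval -mulrA -c'u.
rewrite -(meval_homogZ c (u i.+1) (frob_lift_homog j)) -addSnnS.
by apply: meval_eq => k; apply: cu.
Qed.

End FrobeniusIterates.

(** * Normalised coordinates along the orbit *)

Section NormalizedCoordinates.

Variables (R : realType) (K : fieldType) (v : nonarch_absval R K) (N : nat).
Implicit Types (x : proj_space K N) (z : 'rV[K]_N.+1).

Lemma hcoords_normalized x : hcoords x (normalized_coords v x).
Proof. by have /andP[] := xchooseP (normalized_coords_exist v x). Qed.

Lemma normalized_le1 x j : v (normalized_coords v x 0 j) <= 1.
Proof.
have /andP[_ /eqP <-] := xchooseP (normalized_coords_exist v x).
exact: (Order.TotalTheory.le_bigmax _ (fun j => v (normalized_coords v x 0 j))).
Qed.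

Lemma normalized_unit x : exists j, v (normalized_coords v x 0 j) = 1.
Proof.
have /andP[_ /eqP sup1] := xchooseP (normalized_coords_exist v x).
have [j _ jP] := @Order.TotalTheory.eq_bigmax _ _ _ (0 : R) ord0 xpredT
  (fun j : 'I_N.+1 => v (normalized_coords v x 0 j)) isT (fun j _ => absval_ge0 v _).
by exists j; rewrite -jP.
Qed.

Lemma hcoords_scale x y z : hcoords x y -> hcoords x z -> exists c, z = c *: y.
Proof.
rewrite /hcoords => /eqP xy /eqP xz; apply/vlineP.
by rewrite -xy xz memv_line.
Qed.

Variables (p s : nat) (p' : K) (P : 'I_N.+1 -> {mpoly K[N.+1]}).
Hypotheses (p'_lt1 : v p' < 1) (P_le1 : forall j, mbnd v 1 (P j)).

(** A unit coordinate of [y] bounds [c] by 1 from above. A unit coordinate of [x] stays a unit under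
    the lift, the perturbation by [p'] being below 1, and bounds [c] from below. *)
Lemma frob_lift_orbit x y :
  hcoords y (\row_j (normalized_coords v x 0 j ^+ (p ^ s)
                     + p' * mpeval (P j) (normalized_coords v x))) ->
  exists2 c, v c = 1 & forall j,
    (frob_lift p s p' P j).@[fun k => normalized_coords v x 0 k] = c * normalized_coords v y 0 j.
Proof.
move=> /(hcoords_scale (hcoords_normalized y))[c /rowP cE].
have liftE j : (frob_lift p s p' P j).@[fun k => normalized_coords v x 0 k] =
    c * normalized_coords v y 0 j.
  by have := cE j; rewrite !mxE mevalD mevalZ rmorphXn /= mevalXU.
exists c => //; apply/eqP; rewrite eq_le; apply/andP; split.
  have [j yj] := normalized_unit y.
  rewrite -[v c]mulr1 -[X in _ * X]yj -absvalM -liftE.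
  apply: meval_le => [||k]; [exact: ler01| |exact: normalized_le1].
  exact: (@frob_lift_le1 _ _ _ _ _ _ 1 _ _ (lexx 1) (ltW p'_lt1)).
have [j xj] := normalized_unit x.
have <- : v (c * normalized_coords v y 0 j) = 1.
  rewrite -liftE mevalD mevalZ rmorphXn /= mevalXU addrC absvalD_eqr absvalX xj expr1n //.
  rewrite mulrC; apply: absvalM_lt1 => //.
  by apply: meval_le => // k; apply: normalized_le1.
by rewrite absvalM ler_piMr ?absval_ge0 ?normalized_le1.
Qed.

End NormalizedCoordinates.

Theorem corollary1p9 (R : realType) (p : nat) (hp : prime p)
    (C : fieldType) (v : nonarch_absval R C) (hC : is_Cp p v)
    (N : nat) (F : proj_space C N -> proj_space C N)
    (hF : is_Frobenius_lift p v F)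
    (b : nat -> proj_space C N) (hb : forall i : nat, F (b i.+1) = b i)
    (V : set (proj_space C N)) (hV : is_subvariety V)
    (m : nat) (H : 'I_m -> {mpoly C[N.+1]})
    (hH : defining_equations V H)
    (hH1 : forall i : 'I_m, gauss_norm v (H i) = 1) :
  exists c : R, 0 < c /\ forall i : nat, V (b i) \/ c < dist_to v H (b i).
Proof.
move: hF => [s [p' [P [s_gt0 p'_lt1 P_homog P_le1 hF]]]].
have vp := Cp_absval_p hp hC.
have p_gt0 : 0 < p%:R :> R by rewrite ltr0n prime_gt0.
(* [pi] is the larger of [p] and [p'], so both Frobenius additivity and the lift hold modulo
   [pi]. *)
have [pi [pi0 pi_lt1 p_le p'_le]] : exists pi,
    [/\ pi != 0, v pi < 1, v p%:R <= v pi & v p' <= v pi].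
  have vp_lt1 : v p%:R < 1 by rewrite vp invf_lt1 ?ltr1n ?prime_gt1.
  have vp_gt0 : 0 < v p%:R by rewrite vp invr_gt0.
  have [le_p'|lt_p] := leP (v p') (v p%:R).
    by exists p%:R; split=> //; rewrite -(absval_gt0 v).
  by exists p'; split=> //; [rewrite -(absval_gt0 v) (lt_trans vp_gt0) | exact: ltW].
pose u i j := normalized_coords v (b i) 0 j.
have u_le1 i j : v (u i j) <= 1 by apply: normalized_le1.
have orbit1 i : exists2 c, v c = 1 &
    forall j, (frob_lift p s p' P j).@[u i.+1] = c * u i j.
  by apply: frob_lift_orbit => //; rewrite -hb; apply/hF/hcoords_normalized.
have w0 := absval_ge0 v pi; have w1 := ltW pi_lt1.
have [H_homog V_iff] := hH.
have gap j : exists c : R, 0 < c /\ forall i, (H j).@[u i] = 0 \/ c < v (H j).@[u i].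
  have [d Hd] := H_homog j.
  have H1 : mbnd v 1 (H j) by rewrite -(hH1 j); apply: mbnd_gauss_norm.
  have [||||c c0 cP] := @orbit_gap R p C v hp (fun x => @Cp_teich R p hp C v x hC) pi pi0
    pi_lt1 p_le _ s u (frob_iter p s p' P) s_gt0 u_le1 _ _ _ _ (H j) d Hd H1.
  - exact: frob_iter_homog.
  - exact: frob_iter_le1 p'_le P_le1.
  - exact: frob_iter_cong p'_le P_le1.
  - exact: frob_iter_orbit.
  by exists c.
have [c cP] := boolp.choice gap.
(* The gaps of the [m] equations are extended by 1 to all indices, and a common positive lower bound
   is taken. *)
have [|c0 c0_gt0 c0_le] := @finite_lower_bound R (fun k => oapp c 1 (insub k)) m.
  by move=> k; case: (insub k) => //= j; have [] := cP j.
exists c0; split=> // i.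
have [Vi|nVi] := boolp.pselect (V (b i)); [by left | right].
(* Off [V] some equation is nonzero, and its gap bounds the maximum defining the distance. *)
have [j Hj] : exists j, (H j).@[u i] <> 0.
  apply/boolp.existsNP => all0; apply/nVi/(V_iff _ _ (hcoords_normalized v _)).
  exact: all0.
have c0j : c0 <= c j by have := c0_le j (ltn_ord j); rewrite valK.
have [_ /(_ i)[//|cj]] := cP j.
apply: le_lt_trans c0j _; apply: lt_le_trans cj _.
exact: (Order.TotalTheory.le_bigmax _ (fun k => v (mpeval (H k) (normalized_coords v (b i))))).
Qed.
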